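(* Let $(X,S)$ be an irreducible Markov shift with period $p$ and let $\pi:(X,S)\to(Y,T)$ be a continuous, not necessarily surjective, factor map into a selfhomeomorphism $T$ of a Polish space $Y$ (that is, $\pi:X\to Y$ is continuous and $\pi\circ S=T\circ\pi$). Let $$h_*(\pi):=\sup\{h(T,\pi_*\mu):\mu\text{ an ergodic }S\text{-invariant Borel probability measure on }X\}.$$ For any $0\le h<h_*(\pi)$, there is an irreducible shift of finite type $X'\subset X$ such that $h_{\mathrm{top}}(X')>h$, $X'$ has period $p$, and the restriction of $\pi$ to $X'$ is injective.
   Context: A (countable state) Markov shift is $(X,S)$ where, for a countable (possibly finite) set $V$ and some $E\subset V^2$, $X=\{x\in V^{\mathbb Z}:(x_n,x_{n+1})\in E\ \forall n\in\mathbb Z\}$, with the topology induced by the product of discrete topologies, and $S((x_n)_n)=(x_{n+1})_n$. It is irreducible if it can be presented by a strongly connected directed graph $(V,E)$; its period is then the greatest common divisor of the lengths of all loops of that graph. A shift of finite type (SFT) is a topological dynamical system topologically isomorphic to a compact Markov shift (equivalently, to one presented by a finite graph); here $X'\subset X$ is an $S$-invariant subset with the restriction of $S$. $h(T,\cdot)$ is Kolmogorov–Sinai entropy and $h_{\mathrm{top}}$ is topological entropy. Standing assumption: the irreducible Markov shift $(X,S)$ has finite entropy, i.e. the supremum of the Kolmogorov–Sinai entropies of its invariant probability measures is finite. *)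

(* Defs.v *)
From HB Require Import structures.
From mathcomp Require Import all_boot all_order all_algebra.
From mathcomp Require Import all_classical all_reals all_analysis.

Set Implicit Arguments.
Unset Strict Implicit.
Unset Printing Implicit Defensive.

Import Order.TTheory GRing.Theory Num.Theory.
Import numFieldNormedType.Exports.

Local Open Scope classical_set_scope.
Local Open Scope ring_scope.

Definition homeomorphism (X Y : topologicalType) (f : X -> Y) : Prop :=
  continuous f /\
  exists g : Y -> X, [/\ continuous g, cancel f g & cancel g f].

Definition conjugate (X Y : topologicalType) (f : X -> X) (g : Y -> Y) : Prop :=
  exists phi : X -> Y, homeomorphism phi /\ forall x, phi (f x) = g (phi x).

Definition invariant_set (X : Type) (f : X -> X) (A : set X) : Prop := f @` A = A.

Lemma invariant_mem (X : Type) (f : X -> X) (A : set X) (fA : invariant_set f A)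
  (x : A) : f (set_val x) \in A.
Proof.
have : (f @` A) (f (set_val x)) by exists (set_val x) => //; exact: set_valP.
by rewrite fA => /mem_set.
Qed.

Definition restrict_map (X : Type) (f : X -> X) (A : set X)
    (fA : invariant_set f A) (x : A) : A :=
  exist _ (f (set_val x)) (invariant_mem fA x).

Definition polish (R : realType) (Y : topologicalType) : Prop :=
  (exists D : set Y, countable D /\ dense D) /\
  exists d : Y -> Y -> R,
    [/\ forall x y, 0 <= d x y,
        forall x y, d x y = 0 <-> x = y,
        forall x y, d x y = d y x &
        forall x y z, d x z <= d x y + d y z] /\
    (forall (y : Y) (A : set Y),
       nbhs y A <-> exists2 e : R, 0 < e & [set z | d y z < e] `<=` A) /\
    (forall u : nat -> Y,
       (forall e : R, 0 < e -> exists N : nat, forall m n : nat,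
          (N <= m)%N -> (N <= n)%N -> d (u m) (u n) < e) ->
       exists l : Y, u @ \oo --> l).

Definition shift_seq (V : countType)
    (x : {ptws int -> discrete_topology V}) :
    {ptws int -> discrete_topology V} := fun n => x (n + 1).

Definition markov_shift (V : countType) (E : rel V) :
    set {ptws int -> discrete_topology V} :=
  [set x | forall n : int, E (x n) (x (n + 1))].

Lemma markov_shift_invariant (V : countType) (E : rel V) :
  invariant_set (@shift_seq V) (markov_shift E).
Proof.
rewrite /invariant_set; apply/seteqP; split => [_ [x Ex <-] n|x Ex]; first exact: Ex.
exists (fun n => x (n - 1)) => [n|]; last by apply/funext => n; rewrite /shift_seq addrK.
by have := Ex (n - 1); rewrite subrK addrK.
Qed.

Definition markov_map (V : countType) (E : rel V) :
    markov_shift E -> markov_shift E :=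
  restrict_map (@markov_shift_invariant V E).

Arguments markov_map {V} E _.

Definition strongly_connected (V : countType) (E : rel V) : Prop :=
  forall v w : V, exists s : seq V, path E v s /\ last v s = w.

(* [p] is the greatest common divisor, i.e. the greatest lower bound for
   divisibility, of the lengths of the loops; a loop is a closed walk, which may
   visit a vertex several times. *)
Definition graph_period (V : countType) (E : rel V) (p : nat) : Prop :=
  forall d : nat, (d %| p)%N <->
    forall c : seq V, (0 < size c)%N -> cycle E c -> (d %| size c)%N.

(* [f] is, up to topological isomorphism, an irreducible Markov shift of
   period [p]. *)
Definition irreducible_markov (X : topologicalType) (f : X -> X) (p : nat) :
    Prop :=
  exists (V : countType) (E : rel V),
    [/\ strongly_connected E, graph_period E p & conjugate f (markov_map E)].

Definition shift_of_finite_type (X : topologicalType) (f : X -> X) : Prop :=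
  exists (V : countType) (E : rel V),
    compact [set: markov_shift E] /\ conjugate f (markov_map E).

Section ks_entropy.
Context (R : realType) (d : measure_display) (X : measurableType d).

Definition finite_partition (k : nat) (P : 'I_k -> set X) : Prop :=
  [/\ forall i, measurable (P i), trivIset [set: 'I_k] P &
      \bigcup_i P i = [set: X]].

(* [ln 0 = 0], so null atoms contribute [0] below. *)
Definition static_entropy (mu : set X -> \bar R) (I : finType)
    (P : I -> set X) : R :=
  - \sum_(i : I) fine (mu (P i)) * ln (fine (mu (P i))).

(* The atoms of [P \/ f^-1 P \/ ... \/ f^-(n-1) P], indexed by itineraries. *)
Definition join_partition (f : X -> X) (k : nat) (P : 'I_k -> set X) (n : nat)
    (w : {ffun 'I_n -> 'I_k}) : set X :=
  [set x | forall i : 'I_n, P (w i) (iter i f x)].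

Definition partition_entropy (f : X -> X) (mu : set X -> \bar R) (k : nat)
    (P : 'I_k -> set X) : R :=
  limn (fun n : nat => static_entropy mu (@join_partition f k P n) / n%:R).

Definition ks_entropy (f : X -> X) (mu : set X -> \bar R) : \bar R :=
  ereal_sup [set e | exists (k : nat) (P : 'I_k -> set X),
    finite_partition P /\ e = (partition_entropy f mu P)%:E].

End ks_entropy.

(* Measurable types carry a distinguished point, which topological spaces such as
   [markov_shift E] lack. [borel t] is [T] with its Borel sigma-algebra and with
   distinguished point [t]; as a measurable space it does not depend on [t]. *)
Definition pointed_at (T : topologicalType) (t : T) : Type := T.

HB.instance Definition _ (T : topologicalType) (t : T) :=
  Choice.on (pointed_at t).
HB.instance Definition _ (T : topologicalType) (t : T) :=
  isPointed.Build (pointed_at t) t.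

Notation borel t := (g_sigma_algebraType (@open _ : set (set (pointed_at t)))).

Definition invariant_measure (R : realType) (d : measure_display)
    (X : measurableType d) (f : X -> X) (mu : probability X R) : Prop :=
  forall A : set X, measurable A -> mu (f @^-1` A) = mu A.

Definition ergodic (R : realType) (d : measure_display)
    (X : measurableType d) (f : X -> X) (mu : probability X R) : Prop :=
  invariant_measure f mu /\
  forall A : set X, measurable A -> f @^-1` A = A ->
    mu A = 0%E \/ mu A = 1%E.

(* A space carrying a probability measure has a point, so quantifying over the
   distinguished point [x0] excludes no measure. *)
Definition finite_entropy (R : realType) (X : topologicalType) (f : X -> X) :
    Prop :=
  (ereal_sup [set e | exists (x0 : X) (mu : probability (borel x0) R),
     invariant_measure (f : borel x0 -> borel x0) mu /\
     e = ks_entropy (f : borel x0 -> borel x0) mu] < +oo)%E.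

Definition factor_entropy (R : realType) (X Y : topologicalType) (f : X -> X)
    (g : Y -> Y) (pi : X -> Y) : \bar R :=
  ereal_sup [set e | exists (x0 : X) (mu : probability (borel x0) R),
    ergodic (f : borel x0 -> borel x0) mu /\
    e = ks_entropy (g : borel (pi x0) -> borel (pi x0))
          (pushforward mu (pi : borel x0 -> borel (pi x0)))].

(* Adler-Konheim-McAndrew entropy; meaningful for compact [X]. *)
Section topological_entropy.
Context (R : realType) (X : topologicalType).

Definition open_cover (U : set (set X)) : Prop :=
  (forall A, U A -> open A) /\ \bigcup_(A in U) A = [set: X].

(* The least cardinality of a subcover of [U]; finite subcovers exist when [X]
   is compact. *)
Definition cover_number (U : set (set X)) : R :=
  inf [set m | exists (k : nat) (F : 'I_k -> set X),
    [/\ forall i, U (F i), \bigcup_i F i = [set: X] & m = k%:R]].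

(* The cover [U \/ f^-1 U \/ ... \/ f^-(n-1) U]. *)
Definition join_cover (f : X -> X) (U : set (set X)) (n : nat) : set (set X) :=
  [set A | exists F : 'I_n -> set X, (forall i, U (F i)) /\
    A = \bigcap_(i in [set: 'I_n]) (iter i f @^-1` F i)].

Definition cover_entropy (f : X -> X) (U : set (set X)) : R :=
  limn (fun n : nat => ln (cover_number (join_cover f U n)) / n%:R).

Definition topological_entropy (f : X -> X) : \bar R :=
  ereal_sup [set (cover_entropy f U)%:E | U in open_cover].

End topological_entropy.

(* Main.v *)
(* The names of length n of the points of X with respect to a partition of Y of
   large entropy are exponentially many.  By regularity and continuity of pi,
   outside a set of small measure the label of pi x is read off a finite window
   of x, and different labels force different images.  Discarding names that are
   close in Hamming distance leaves many loops of a common length L at a vertex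
   v such that aligned occurrences of different loops have different images; for
   the same reason all but L of them differ in image from every rotation of a
   fixed loop A.  Let B be one of the others.  The point A^oo.B^oo and its
   translates have different images, so the marker A^r B^r can be located in a
   sequence from its image only.  The concatenations of the words
   A^r B^r f_1 ... f_K and A^r B^r f_1 ... f_K Q, where the f_i are free among
   the loops and the length of Q adjusts the period, form the required shift. *)

From HB Require Import structures.
Require Import Defs.
From mathcomp Require Import all_boot all_order all_algebra.
From mathcomp Require Import all_classical all_reals all_analysis.
From mathcomp Require Import zify ring lra.

Set Implicit Arguments.
Unset Strict Implicit.
Unset Printing Implicit Defensive.

Import Order.TTheory GRing.Theory Num.Theory.
Import numFieldNormedType.Exports.

Local Open Scope classical_set_scope.
Local Open Scope ring_scope.

(** * Graphs of towers *)

(** The obstacle is that the block structure must be recognised from images under [pi] alone: two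
    label sequences may differ visibly and still have the same image. Recognition is therefore
    phrased through the relation of having equal images, of which three properties serve: it is an
    equivalence, it is invariant under all shifts, and its complement is open, so that a difference
    of images is already forced by finite windows. The window needed to tell two positions of the
    marker apart depends on how large their offset can be. The runs of [A] bound this offset by 2L +
    |Q|, whatever the number r of repetitions; hence r can be chosen after the window, and K after
    r, large enough for the marker to cost little entropy. As the alphabet may be infinite, words
    are counted by the labels of their images, and their two end letters are confined to a finite
    set so that the paths closing them up to loops have bounded length. The two superblock lengths
    are NL and NL + |Q|, with N congruent to 1 modulo |Q| and |Q| congruent to p modulo L; this
    makes their greatest common divisor p. *)

Section tower_graph.
Variables (B : finType) (len : B -> nat).
Hypothesis len_gt0 : forall b, (0 < len b)%N.

Definition tower : Type :=
  {x : B * 'I_(\max_b len b) | (x.2 < len x.1)%N}.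
HB.instance Definition _ := Finite.on tower.

Definition tower_base (x : tower) : B := (val x).1.
Definition tower_level (x : tower) : nat := (val x).2.

(** From the top of a tower every bottom is reachable, so a bi-infinite walk is an arbitrary
    bi-infinite concatenation of bases together with the position of the origin in it. *)
Definition tower_edge : rel tower := fun x y =>
  if (tower_level x).+1 == len (tower_base x) then tower_level y == 0%N
  else (tower_base y == tower_base x) && (tower_level y == (tower_level x).+1).

Lemma tower_level_lt x : (tower_level x < len (tower_base x))%N.
Proof. exact: (valP x). Qed.

Lemma tower_ext x y :
  tower_base x = tower_base y -> tower_level x = tower_level y -> x = y.
Proof.
move=> bxy lxy; apply: val_inj; move: bxy lxy; rewrite /tower_base /tower_level.
by case: (val x) (val y) => [b i] [c j] /= -> /val_inj ->.
Qed.

Lemma tower_exists b i : (i < len b)%N ->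
  exists x, tower_base x = b /\ tower_level x = i.
Proof.
move=> ib; have iM : (i < \max_b len b)%N by exact: leq_trans ib (leq_bigmax b).
by exists (exist _ (b, Ordinal iM) ib).
Qed.

Lemma tower_path_level d x s : (forall b, (d %| len b)%N) ->
  path tower_edge x s ->
  tower_level (last x s) = (tower_level x + size s)%N %[mod d].
Proof.
move=> dlen; elim: s x => [|y s IH] x /=; first by rewrite addn0.
case/andP=> xy /IH ->; rewrite addnS -addSn -[in LHS]modnDml -[in RHS]modnDml.
congr ((_ + _) %% _)%N; move: xy; rewrite /tower_edge.
case: eqP => [-> /eqP ->|_ /andP[_ /eqP ->] //].
by rewrite mod0n; apply/esym/eqP; exact: dlen.
Qed.

Lemma tower_cycle_size d c : (forall b, (d %| len b)%N) ->
  cycle tower_edge c -> (d %| size c)%N.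
Proof.
case: c => [|x s] dlen /=; first by rewrite dvdn0.
move=> /(tower_path_level dlen); rewrite last_rcons size_rcons => /eqP.
by rewrite -[X in X == _ %[mod _]]addn0 eqn_modDl mod0n eq_sym.
Qed.

Lemma tower_climb x k : (tower_level x + k < len (tower_base x))%N ->
  exists s, [/\ path tower_edge x s, size s = k,
    tower_base (last x s) = tower_base x &
    tower_level (last x s) = (tower_level x + k)%N].
Proof.
elim: k => [|k IH] xk; first by exists [::]; rewrite addn0.
have [|s [ps sk sb sl]] := IH; first by lia.
have [y [yb yl]] := tower_exists xk.
exists (rcons s y); rewrite rcons_path size_rcons last_rcons ps yb yl sk; split=> //.
rewrite /tower_edge /= sb sl yb yl; case: eqP => [|_]; first by lia.
by rewrite eqxx addnS eqxx.
Qed.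

Lemma tower_strongly_connected : strongly_connected tower_edge.
Proof.
move=> x y; have xl := tower_level_lt x; have yl := tower_level_lt y.
have [|s [ps _ sb sl]] := @tower_climb x (len (tower_base x) - (tower_level x).+1).
  by lia.
have [u [ub ul]] := tower_exists (len_gt0 (tower_base y)).
have [|t [pt _ tb tl]] := @tower_climb u (tower_level y); first by rewrite ub ul.
exists (s ++ u :: t); rewrite cat_path last_cat /= ps pt andbT; split.
  by rewrite /tower_edge sb sl ul; case: eqP => //; lia.
by apply: tower_ext; rewrite ?tb ?ub // tl ul.
Qed.

(** Modulo a common divisor of the lengths the level grows by one along each edge, which constrains
    every loop; conversely each tower, closed up at its top, is itself a loop of length [len b]. *)
Lemma tower_graph_period p : (forall b, (p %| len b)%N) ->
  (forall d, (forall b, (d %| len b)%N) -> (d %| p)%N) ->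
  graph_period tower_edge p.
Proof.
move=> plen plub d; split=> [dp c _ cc|dc].
  by apply: tower_cycle_size cc => b; exact: dvdn_trans dp (plen b).
apply: plub => b; have bl := len_gt0 b.
have [u [ub ul]] := tower_exists bl.
have [|s [ps ss sb sl]] := @tower_climb u (len b).-1; first by rewrite ub ul; lia.
have -> : len b = size (u :: s) by rewrite /= ss; lia.
apply: dc => //=; rewrite rcons_path ps /= /tower_edge sb sl ub ul.
by case: eqP => //; lia.
Qed.

Section walk.
Variable w : int -> tower.
Hypothesis wE : forall n, tower_edge (w n) (w (n + 1)).

Lemma walk_forward n k :
  (tower_level (w n) + k < len (tower_base (w n)))%N ->
  tower_base (w (n + k%:Z)) = tower_base (w n) /\
  tower_level (w (n + k%:Z)) = (tower_level (w n) + k)%N.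
Proof.
elim: k => [|k IH] nk; first by rewrite addr0 addn0.
have [|b l] := IH; first by lia.
have := wE (n + k%:Z); rewrite /tower_edge b l.
have -> : n + k%:Z + 1 = n + k.+1%:Z by lia.
by case: eqP => [|_ /andP[/eqP -> /eqP ->]]; [lia|rewrite addnS].
Qed.

Lemma walk_next n : tower_level (w n) = 0%N ->
  tower_level (w (n + (len (tower_base (w n)))%:Z)) = 0%N.
Proof.
move=> n0; have bl := len_gt0 (tower_base (w n)).
have [|b l] := @walk_forward n (len (tower_base (w n))).-1; first by lia.
have := wE (n + (len (tower_base (w n))).-1%:Z); rewrite /tower_edge b l n0.
rewrite add0n prednK // eqxx => /eqP <-; congr (tower_level (w _)); lia.
Qed.

Lemma walk_back n :
  tower_base (w (n - (tower_level (w n))%:Z)) = tower_base (w n) /\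
  tower_level (w (n - (tower_level (w n))%:Z)) = 0%N.
Proof.
move: {2}(tower_level _) (erefl (tower_level (w n))) => i; elim: i n => [|i IH] n ni.
  by rewrite ni subr0.
have := wE (n - 1); rewrite subrK /tower_edge ni.
case: eqP => // _ /andP[/eqP eb /eqP[el]].
have [] := IH (n - 1) (esym el).
rewrite -el -eb; have -> : n - 1 - i%:Z = n - i.+1%:Z by lia.
by [].
Qed.

End walk.

End tower_graph.

(** * Coding by superblocks *)

Definition shift_by (V : Type) (d : int) (x : int -> V) : int -> V :=
  fun n => x (n + d).

(** The point A^oo.B^oo, with B starting at the origin. The integer remainder is nonnegative on both
    sides, so both halves are in phase with the multiples of [L]. *)
Definition switch_point (V : Type) (L : nat) (A B : nat -> V) (n : int) : V :=
  if n < 0 then A (absz (n %% L%:Z)%Z) else B (absz (n %% L%:Z)%Z).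

Section marker_coding.
Variables (V : Type) (I : finType) (L K r lQ : nat).
Variables (A Q : nat -> V) (beta : I -> nat -> V) (i0 : I).
Hypotheses (L_gt0 : (0 < L)%N) (lQ_gt0 : (0 < lQ)%N) (r_ge4 : (4 <= r)%N).

Definition block_word (o : option I) : nat -> V := oapp beta A o.

Definition superblock : finType := (bool * {ffun 'I_K -> I})%type.

Definition superblock_len (b : superblock) : nat :=
  ((r + r + K) * L + (if b.1 then lQ else 0))%N.

(* [None] stands for the word [A]: the superblock of [b] reads [A] and [beta i0],
   [r] times each, then the [K] free words given by [b.2], then [Q] if [b.1]. *)
Definition superblock_index (b : superblock) (j : nat) : option I :=
  if (j < r)%N then None
  else if (j < r + r)%N then Some i0
  else Some (oapp b.2 i0 (insub (j - (r + r))%N)).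

Definition superblock_letter (b : superblock) (s : nat) : V :=
  if (s < (r + r + K) * L)%N then block_word (superblock_index b (s %/ L)) (s %% L)
  else Q (s - (r + r + K) * L).

Lemma superblock_len_gt0 b : (0 < superblock_len b)%N.
Proof. by rewrite /superblock_len; lia. Qed.

Notation tow := (tower superblock_len).
Notation base := (@tower_base _ superblock_len).
Notation level := (@tower_level _ superblock_len).

Definition tower_label (x : tow) : V := superblock_letter (base x) (level x).

Notation marker_point := (switch_point L A (beta i0)).

Section walk_label.
Variable w : int -> tow.
Hypothesis wE : forall n, tower_edge (w n) (w (n + 1)).
Variable a : int.
Hypothesis a0 : level (w a) = 0%N.

Lemma walk_label (s : nat) : (s < (r + r + K) * L)%N ->
  tower_label (w (a + s%:Z)) =
  block_word (superblock_index (base (w a)) (s %/ L)) (s %% L).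
Proof.
move=> sl; have [|b l] := @walk_forward _ _ w wE a s.
  by rewrite a0 /superblock_len; lia.
by rewrite /tower_label b l a0 add0n /superblock_letter sl.
Qed.

Lemma walk_label_block j (l : nat) : (j < r + r + K)%N -> (l < L)%N ->
  tower_label (w (a + (j * L)%N%:Z + l%:Z)) =
  block_word (superblock_index (base (w a)) j) l.
Proof.
move=> jK lL.
have -> : a + (j * L)%N%:Z + l%:Z = a + (j * L + l)%N%:Z by lia.
rewrite walk_label; last by nia.
by rewrite divnMDl // modnMDl divn_small // modn_small // addn0.
Qed.

Lemma walk_label_run (s : nat) : (s < r * L)%N ->
  tower_label (w (a + s%:Z)) = A (s %% L)%N.
Proof.
move=> sl; rewrite walk_label; last by nia.
by rewrite /superblock_index ltn_divLR // sl.
Qed.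

Lemma walk_label_marker (n : int) : - (r * L)%N%:Z <= n < (r * L)%N%:Z ->
  tower_label (w (a + (r * L)%N%:Z + n)) = marker_point n.
Proof.
move=> nr; have [s sE] : exists s : nat, n = s%:Z - (r * L)%N%:Z.
  by exists (absz (n + (r * L)%N%:Z)%R); lia.
have -> : a + (r * L)%N%:Z + n = a + s%:Z by rewrite sE; lia.
rewrite walk_label; last by nia.
have nL : (n %% L%:Z)%Z = (s %% L)%N%:Z.
  by rewrite sE PoszM addrC -mulNr modzMDl modz_nat.
rewrite /switch_point nL absz_nat /superblock_index.
case: ltnP => sr.
  have -> : n < 0 by move: sr; rewrite ltn_divLR //; lia.
  by [].
have -> : (n < 0) = false by move: sr; rewrite leq_divRL //; lia.
have -> : (s %/ L < r + r)%N by rewrite ltn_divLR //; lia.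
by [].
Qed.

End walk_label.

(** * Recovering a walk when [R], standing for equality of images, relates its reading to another *)

Section injectivity.
Variable D : nat.
Hypothesis D_ge : (2 * L + lQ <= D)%N.
Variable R : (int -> V) -> (int -> V) -> Prop.
Hypothesis R_sym : forall x y, R x y -> R y x.
Hypothesis R_shift : forall x y d, R x y -> R (shift_by d x) (shift_by d y).
Hypothesis aligned_sep : forall i j x y, i != j ->
  (forall l : nat, (l < L)%N -> x l%:Z = beta i l) ->
  (forall l : nat, (l < L)%N -> y l%:Z = beta j l) -> ~ R x y.
Hypothesis run_sep : forall i t x y,
  (forall l : nat, (l < L)%N -> x l%:Z = beta i l) ->
  (forall l : nat, (l < L)%N -> y l%:Z = A ((t + l) %% L)%N) -> ~ R x y.
Hypothesis marker_sep : forall (d : int) (x y : int -> V), d != 0 -> `|d| <= D%:Z ->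
  (forall n : int, - (r * L)%N%:Z <= n < (r * L)%N%:Z -> x n = marker_point n) ->
  (forall n : int, - (r * L)%N%:Z <= n < (r * L)%N%:Z -> y (n - d) = marker_point n) ->
  ~ R x y.

Notation read w := (fun n => tower_label (w n)).

Section pair.
Variables w w' : int -> tow.
Hypothesis wE : forall n, tower_edge (w n) (w (n + 1)).
Hypothesis wE' : forall n, tower_edge (w' n) (w' (n + 1)).
Hypothesis ww' : R (read w) (read w').

(** A block of index at least [r] reads some [beta i]. Lying inside the run of [A] of the other walk
    it would face a rotation of [A], which [run_sep] excludes. *)
Lemma run_no_block a a' j : level (w a) = 0%N -> level (w' a') = 0%N ->
  (j < r + r + K)%N -> a <= a' + (j * L)%N%:Z ->
  a' + (j * L)%N%:Z + L%:Z <= a + (r * L)%N%:Z -> (j < r)%N.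
Proof.
move=> wa wa' jK lo hi.
case: (ltnP j r) => // rj.
have [i jE] : exists i, superblock_index (base (w' a')) j = Some i.
  by rewrite /superblock_index ltnNge rj /=; case: ifP => _; eexists.
have [t tE] : exists t : nat, a' + (j * L)%N%:Z = a + t%:Z.
  by exists (absz (a' + (j * L)%N%:Z - a)%R); lia.
case: (run_sep (i := i) (t := t) _ _ (R_sym (R_shift (a' + (j * L)%N%:Z) ww'))).
  by move=> l lL; rewrite /shift_by addrC walk_label_block // jE.
move=> l lL; rewrite /shift_by tE.
have -> : l%:Z + (a + t%:Z) = a + (t + l)%N%:Z by lia.
by rewrite walk_label_run //; lia.
Qed.

(** The position [n0], one block inside the run of [w], lies in some superblock of [w']. If it is in
    the last block or in [Q], the next start of [w'] is near; otherwise the start of this superblock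
    is shown to be near. *)
Lemma start_near a : level (w a) = 0%N ->
  exists a', level (w' a') = 0%N /\ `|a - a'| <= (2 * L + lQ)%N%:Z.
Proof.
move=> wa; set n0 := a + L%:Z.
have [] := walk_back wE' n0.
set i := level (w' n0); set a' := n0 - i%:Z => bE a'0.
have lt_i := tower_level_lt (w' n0); rewrite -/i -bE in lt_i.
have nxt := walk_next superblock_len_gt0 wE' a'0.
have lenle : (superblock_len (base (w' a')) <= (r + r + K) * L + lQ)%N.
  by rewrite /superblock_len leq_add2l; case: ifP.
have [iK|iK] := leqP ((r + r + K) * L) i.
  exists (a' + (superblock_len (base (w' a')))%:Z); split=> //.
  by move: lt_i lenle iK nxt; rewrite /a' /n0; lia.
have jL := leq_trunc_div i L; have jL1 := ltn_ceil i L_gt0.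
set j := (i %/ L)%N in jL jL1.
have jK : (j < r + r + K)%N by rewrite /j ltn_divLR.
move: jK; rewrite leq_eqVlt => /orP[/eqP jK|jK].
  exists (a' + (superblock_len (base (w' a')))%:Z); split=> //.
  by move: lt_i lenle iK nxt jL1; rewrite /a' /n0 jK; lia.
(* The next block of [w'] starts at most [L] after [n0], hence ends by a + 3L, still inside the run
   of [w]. *)
have jr : (j.+1 < r)%N.
  by apply: (run_no_block wa a'0 jK); rewrite /a' /n0; nia.
exists a'; split=> //.
have ir : (i < r * L)%N by nia.
(* A start [a'] further to the left would bring block [r] of [w'], the first one reading [beta i0],
   inside the run of [w] as well. *)
rewrite leNgt; apply/negP => far.
suff : (r < r)%N by rewrite ltnn.
by apply: (run_no_block wa a'0); move: far; rewrite /a' /n0; nia.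
Qed.

(** Distinct starts that are near would put two markers at a nonzero offset of at most [D], against
    [marker_sep]. *)
Lemma start_same a : level (w a) = 0%N -> level (w' a) = 0%N.
Proof.
move=> wa; have [a' [wa' near]] := start_near wa.
have [<- //|aa'] := eqVneq a' a.
case: (marker_sep (d := a - a') _ _ _ _ (R_shift (a + (r * L)%N%:Z) ww')).
- by rewrite subr_eq0 eq_sym.
- by lia.
- by move=> n nr; rewrite /shift_by addrC walk_label_marker.
- move=> n nr; rewrite /shift_by -(walk_label_marker wE' wa') //.
  by congr (tower_label (w' _)); lia.
Qed.

End pair.

(** Both walks have the same starts, hence the same superblock lengths. As [lQ] is positive the
    lengths reveal whether [Q] is present, and the free loops, now aligned, are told apart by
    [aligned_sep]. *)
Lemma marker_coding_inj w w' :
  (forall n, tower_edge (w n) (w (n + 1))) ->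
  (forall n, tower_edge (w' n) (w' (n + 1))) ->
  R (read w) (read w') -> w = w'.
Proof.
move=> wE wE' ww'; apply/funext => n.
have [] := walk_back wE n; set a := n - _ => ba wa.
have wa' := start_same wE wE' ww' wa.
have lenE : superblock_len (base (w a)) = superblock_len (base (w' a)).
  (* If the superblock of [u] were the shorter one, its end would be a start of [u'] strictly inside
     a superblock of [u']. *)
  have no u u' : (forall n, tower_edge (u n) (u (n + 1))) ->
      (forall n, tower_edge (u' n) (u' (n + 1))) -> R (read u) (read u') ->
      level (u a) = 0%N -> level (u' a) = 0%N ->
      (superblock_len (base (u' a)) <= superblock_len (base (u a)))%N.
    move=> uE uE' uu' ua ua'; rewrite leqNgt; apply/negP => lt.
    have := start_same uE uE' uu' (walk_next superblock_len_gt0 uE ua).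
    have [|_ ->] := walk_forward (k := superblock_len (base (u a))) uE' (n := a).
      by rewrite ua' add0n.
    by have := superblock_len_gt0 (base (u a)); lia.
  by apply/eqP; rewrite eqn_leq !no //; exact: R_sym.
have bE : base (w a) = base (w' a).
  move: lenE (walk_label_block wE wa) (walk_label_block wE' wa').
  case: (base (w a)) (base (w' a)) => [q f] [q' f'].
  rewrite /superblock_len /= => lenE wl wl'.
  have qq' : q = q' by move: lenE lQ_gt0; clear; case: q; case: q' => //=; lia.
  subst q'.
  congr (_, _); apply/ffunP => k; apply/eqP; apply: contraT => ff'.
  have kK : (r + r + k < r + r + K)%N by have := ltn_ord k; lia.
  have idx g : superblock_index (q, g) (r + r + k) = Some (g k).
    rewrite /superblock_index ltnNge -addnA leq_addr /= addnA ltnNge leq_addr /=.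
    by rewrite addKn valK.
  case: (aligned_sep ff' _ _ (R_shift (a + ((r + r + k) * L)%N%:Z) ww')).
    by move=> l lL; rewrite /shift_by addrC wl // idx.
  move=> l lL; rewrite /shift_by addrC wl' //.
  by move: (idx f'); rewrite /superblock_index /= => ->.
have nE : n = a + (level (w n))%:Z by rewrite /a subrK.
have nl := tower_level_lt (w n); rewrite -ba in nl.
have [|b l] := walk_forward (k := level (w n)) wE (n := a); first by rewrite wa.
have [|b' l'] := walk_forward (k := level (w n)) wE' (n := a).
  by rewrite wa' -bE.
rewrite [in RHS]nE [in LHS]nE; apply: tower_ext; first by rewrite b b' bE.
by rewrite l l' wa wa'.
Qed.

End injectivity.

End marker_coding.

(** * Closed walks and the period *)

(** The word proper consists of the letters 0, ..., l - 1. The value at [l] records the end vertex,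
    which is the first letter of any word appended to it; later values are irrelevant. *)
Definition walk_word (V : Type) (E : rel V) (v w : V) (l : nat) (a : nat -> V) :
    Prop :=
  [/\ a 0%N = v, a l = w & forall i, (i < l)%N -> E (a i) (a i.+1)].

Section walk_words.
Variables (V : countType) (E : rel V).

Definition cat_word (l : nat) (a b : nat -> V) : nat -> V :=
  fun i => if (i < l)%N then a i else b (i - l)%N.

Lemma walk_word_cat u v w k l a b : walk_word E u v k a -> walk_word E v w l b ->
  walk_word E u w (k + l) (cat_word k a b).
Proof.
move=> [a0 ak aE] [b0 bl bE]; rewrite /cat_word; split.
- by case: k a0 ak aE => [|k] //= au av _; rewrite b0 -av.
- by rewrite ltnNge leq_addr addKn.
- move=> i ikl; case: (ltnP i.+1 k) => ik; first by rewrite ltnW //; exact/aE/ltnW.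
  case: (ltnP i k) => ik'.
    have ek : k = i.+1 by lia.
    by rewrite -ek subnn b0 -ak ek; exact: aE.
  by rewrite subSn //; apply: bE; lia.
Qed.

Lemma path_walk_word v s : path E v s ->
  walk_word E v (last v s) (size s) (nth v (v :: s)).
Proof.
move=> /(pathP v) ps; split=> //; by rewrite (last_nth v).
Qed.

Lemma closed_walk_cycle v l a : (0 < l)%N -> walk_word E v v l a ->
  cycle E [seq a i | i <- iota 0 l].
Proof.
case: l => // l _ [a0 al aE] /=; apply/(pathP v) => i.
rewrite size_rcons size_map size_iota => il.
have -> : nth v (rcons [seq a i0 | i0 <- iota 1 l] (a 0%N)) i = a i.+1.
  rewrite nth_rcons size_map size_iota; case: ltngtP => [h|h|->].
  - by rewrite (nth_map 0%N) ?size_iota // nth_iota.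
  - by lia.
  - by rewrite a0 al.
have -> : nth v (a 0%N :: rcons [seq a i0 | i0 <- iota 1 l] (a 0%N)) i = a i.
  case: i il => //= i; rewrite ltnS => il; rewrite nth_rcons size_map size_iota il.
  by rewrite (nth_map 0%N) ?size_iota // nth_iota.
exact: aE.
Qed.

Hypothesis E_conn : strongly_connected E.

Lemma connected_walk_word v w : exists l a, walk_word E v w l a.
Proof.
have [s [/path_walk_word ps <-]] := E_conn v w.
by exists (size s), (nth v (v :: s)).
Qed.

Variable p : nat.
Hypothesis E_per : graph_period E p.

Lemma period_dvdn_closed_walk v l a : walk_word E v v l a -> (p %| l)%N.
Proof.
case: l => [|l] wa; first by rewrite dvdn0.
have := (E_per p).1 (dvdnn p) [seq a i | i <- iota 0 l.+1].
by rewrite size_map size_iota; apply=> //; exact: closed_walk_cycle wa.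
Qed.

Section closed_walk_lengths.
Variable v : V.

Definition closed_length (l : nat) : Prop := exists a, walk_word E v v l a.

Lemma closed_lengthD k l :
  closed_length k -> closed_length l -> closed_length (k + l).
Proof. by move=> [a wa] [b wb]; eexists; exact: walk_word_cat wa wb. Qed.

Lemma closed_lengthM k l : closed_length l -> closed_length (k * l).
Proof.
move=> cl; elim: k => [|k IH]; last by rewrite mulSn; exact: closed_lengthD.
by exists (fun=> v).
Qed.

(** A loop based elsewhere can be inserted into a closed walk from [v] through its base point; the
    two lengths at [v] differ by the length of the loop. *)
Lemma dvdn_closed_length_period d :
  (forall l, closed_length l -> (d %| l)%N) -> (d %| p)%N.
Proof.
move=> dl; apply/(E_per d).2 => -[//|x s] _ /= xs.
have [k [a wa]] := connected_walk_word v x.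
have [l [b wb]] := connected_walk_word x v.
have := path_walk_word xs; rewrite last_rcons size_rcons => wc.
have d1 : (d %| k + l)%N by apply: dl; eexists; exact: walk_word_cat wa wb.
have d2 : (d %| k + ((size s).+1 + l))%N.
  by apply: dl; eexists; exact: walk_word_cat wa (walk_word_cat wc wb).
by move: d2; rewrite addnCA dvdn_addl.
Qed.

(* The residues modulo [L] of the lengths of the loops at [v] form a subgroup of
   [Z/L], whose least positive element divides, hence represents, the period. *)
Lemma closed_length_period (L : nat) : (0 < L)%N -> closed_length L ->
  exists l, closed_length (l * L + p)%N.
Proof.
move=> L0 cL.
pose P d := (0 < d)%N && `[< exists k, closed_length (k * L + d) >].
have exP : exists d, P d by exists L; rewrite /P L0; apply/asboolP; exists 0%N.
case: (ex_minnP exP) => d /andP[d0 /asboolP[k ck]] dmin.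
have dall l : closed_length l -> (d %| l)%N.
  move=> cl; rewrite /dvdn; apply: contraT => r0.
  have : P (l %% d)%N.
    rewrite /P lt0n r0; apply/asboolP.
    (* Modulo [L], adding [L.-1] copies amounts to subtracting one: the walk of length [l] is
       followed by [l %/ d * L.-1] closed walks of length k * L + d. *)
    exists (l %/ d * (d + L.-1 * k))%N.
    have := closed_lengthD cl (closed_lengthM (l %/ d * L.-1) ck).
    congr closed_length; rewrite {1}(divn_eq l d).
    by move: L0; case: (L) => // n _ /=; ring.
  by move=> /dmin; rewrite leqNgt ltn_mod d0.
have [q ->] := dvdnP (dvdn_closed_length_period dall).
exists (q * k)%N; have := closed_lengthM q ck.
by rewrite mulnDr mulnA.
Qed.

End closed_walk_lengths.

End walk_words.

(** Here [l] is the length of [Q] and [(c * l).+1] the number of blocks in a superblock. The residue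
    1 modulo [l] is what forces a common divisor of both superblock lengths to divide [L]. *)
Lemma dvdn_period_superblock p d L l c :
  (d %| (c * l).+1 * L)%N -> (d %| l)%N -> (exists k, l = (k * L + p)%N) ->
  (d %| p)%N.
Proof.
move=> d1 dl [k lE].
have dL : (d %| L)%N.
  by move: d1; rewrite mulSn addnC dvdn_addr // -mulnA dvdn_mull // dvdn_mulr.
by move: dl; rewrite lE dvdn_addr // dvdn_mull.
Qed.

(** * Superblocks as closed walks of the graph *)

Section superblock_walks.
Variables (V : countType) (E : rel V) (v : V).
Variables (I : finType) (L K r lQ : nat).
Variables (A Q : nat -> V) (beta : I -> nat -> V) (i0 : I).
Hypotheses (L_gt0 : (0 < L)%N) (r_gt0 : (0 < r)%N).
Hypothesis A_walk : walk_word E v v L A.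
Hypothesis beta_walk : forall i, walk_word E v v L (beta i).
Hypothesis Q_walk : walk_word E v v lQ Q.

Notation letter := (@superblock_letter V I L K r A Q beta i0).

Lemma block_word_walk o : walk_word E v v L (block_word A beta o).
Proof. by case: o => [i|] /=. Qed.

Lemma superblock_walk (b : superblock I K) :
  walk_word E v v (superblock_len L r lQ b) (letter b).
Proof.
have [Q0 Ql QE] := Q_walk.
have N0 : (0 < (r + r + K) * L)%N by rewrite muln_gt0 L_gt0 andbT; lia.
split.
- rewrite /superblock_letter N0 div0n mod0n.
  by have [-> _ _] := block_word_walk (superblock_index r i0 b 0).
- rewrite /superblock_letter /superblock_len; case: b.1.
    by rewrite ltnNge leq_addr addKn.
  by rewrite addn0 ltnn subnn.
- move=> s sl; rewrite /superblock_letter.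
  have [sN|sN] := ltnP s ((r + r + K) * L); last first.
    rewrite ltnNge (leq_trans sN) //= subSn //; apply: QE.
    by move: sl; rewrite /superblock_len; case: b.1; lia.
  have [b0 bl bE] := block_word_walk (superblock_index r i0 b (s %/ L)).
  have sm : (s %% L < L)%N by rewrite ltn_mod.
  have sE := divn_eq s L.
  have [lt|] := ltnP (s %% L).+1 L.
    have -> : (s.+1 < (r + r + K) * L)%N.
      by move: sN sm lt; rewrite sE -ltn_divLR // => h; nia.
    have -> : (s.+1 %/ L = s %/ L)%N.
      by rewrite {1}sE -addnS divnMDl // (divn_small lt) addn0.
    have -> : (s.+1 %% L = (s %% L).+1)%N.
      by rewrite {1}sE -addnS modnMDl modn_small.
    exact: bE.
  (* At the last letter of a block, the next letter begins a block or [Q], or is the end vertex of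
     the superblock; in each case it is [v]. *)
  move=> ge; have e : (s %% L).+1 = L by apply/eqP; rewrite eqn_leq sm.
  have -> : (if (s.+1 < (r + r + K) * L)%N then
        block_word A beta (superblock_index r i0 b (s.+1 %/ L)) (s.+1 %% L)
      else Q (s.+1 - (r + r + K) * L)%N) = v.
    have s1 : s.+1 = ((s %/ L).+1 * L)%N by rewrite {1}sE -addnS e mulSn addnC.
    case: ltnP => h.
      rewrite s1 mulnK // modnMl.
      by have [-> _ _] := block_word_walk (superblock_index r i0 b (s %/ L).+1).
    have -> : (s.+1 - (r + r + K) * L = 0)%N by lia.
    by [].
  by have := bE _ sm; rewrite e bl.
Qed.

Lemma tower_label_edge (x y : tower (@superblock_len I L K r lQ)) : tower_edge x y ->
  E (tower_label A Q beta i0 x) (tower_label A Q beta i0 y).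
Proof.
have xl := tower_level_lt x; rewrite /tower_edge /tower_label.
have [b0 bl bE] := superblock_walk (tower_base x).
case: eqP => [e /eqP ->|_ /andP[/eqP -> /eqP ->]]; last exact: bE.
have [-> _ _] := superblock_walk (tower_base y).
by rewrite -bl -e; exact: bE.
Qed.

End superblock_walks.

(** * Separating A^oo.B^oo from its translates *)

Definition agree (V : Type) (m : nat) (x y : int -> V) : Prop :=
  forall n : int, `|n| <= m%:Z -> x n = y n.

Definition markov_point (V : Type) (E : rel V) (x : int -> V) : Prop :=
  forall n : int, E (x n) (x (n + 1)).

Definition periodic_point (V : Type) (L : nat) (A : nat -> V) : int -> V :=
  fun n => A (absz (n %% L%:Z)%Z).

Lemma absz_mod_lt (L : nat) (n : int) : (0 < L)%N -> (absz (n %% L%:Z)%Z < L)%N.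
Proof.
move=> L0; have := @ltz_pmod n L%:Z; have := @modz_ge0 n L%:Z; lia.
Qed.

Lemma absz_modS (L : nat) (n : int) : (0 < L)%N ->
  absz ((n + 1) %% L%:Z)%Z =
  if (absz (n %% L%:Z)%Z).+1 == L then 0%N else (absz (n %% L%:Z)%Z).+1.
Proof.
move=> L0; have kL := absz_mod_lt n L0; have := divz_eq n L%:Z.
have -> : (n %% L%:Z)%Z = (absz (n %% L%:Z)%Z)%:Z.
  by rewrite gez0_abs // modz_ge0 //; lia.
move: (absz _) kL => k kL nE.
rewrite {1}nE -addrA modzMDl; have -> : (k%:Z + 1 = k.+1%:Z) by lia.
rewrite modz_nat absz_nat /=; case: eqP => [->|ne]; first by rewrite modnn.
by rewrite modn_small //; lia.
Qed.

Section marker_separation.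
Variables (V : countType) (E : rel V) (v : V).
Variables (L : nat) (A B : nat -> V).
Hypothesis L_gt0 : (0 < L)%N.
Hypothesis A_walk : walk_word E v v L A.
Hypothesis B_walk : walk_word E v v L B.

Lemma walk_word_mod (C C' : nat -> V) (n : int) :
  walk_word E v v L C -> walk_word E v v L C' ->
  ((absz (n %% L%:Z)%Z).+1 = L \/ C = C') ->
  E (C (absz (n %% L%:Z)%Z)) (C' (absz ((n + 1) %% L%:Z)%Z)).
Proof.
move=> [C0 CL CE] [C0' CL' CE']; have kL := absz_mod_lt n L_gt0.
rewrite absz_modS //; case: eqP => [e _|ne [//|eC]].
  by rewrite C0' -CL; have := CE _ kL; rewrite e.
by rewrite -eC; exact: CE.
Qed.

Lemma periodic_point_markov (C : nat -> V) : walk_word E v v L C ->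
  markov_point E (periodic_point L C).
Proof. by move=> Cw n; apply: walk_word_mod => //; right. Qed.

Notation z0 := (switch_point L A B).

Lemma switch_point_markov : markov_point E z0.
Proof.
move=> n; rewrite /switch_point; case: ltP => n0; case: ltP => n1.
- by apply: walk_word_mod => //; right.
- apply: walk_word_mod => //; left; have -> : n = - 1 by lia.
  by have := @absz_modS L (- 1) L_gt0; rewrite addrC subrr mod0z; case: eqP.
- by lia.
- by apply: walk_word_mod => //; right.
Qed.

Variable R : (int -> V) -> (int -> V) -> Prop.
Hypothesis R_sym : forall x y, R x y -> R y x.
Hypothesis R_trans : forall x y z, R x y -> R y z -> R x z.
Hypothesis R_shift : forall x y d, R x y -> R (shift_by d x) (shift_by d y).
Hypothesis R_sep : forall x y, markov_point E x -> markov_point E y -> ~ R x y ->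
  exists m, forall x' y', agree m x' x -> agree m y' y -> ~ R x' y'.
Hypothesis AB_sep : ~ R (periodic_point L A) (periodic_point L B).

(* If [R] identified the switch point with one of its translates then it would
   identify it with translates far to the left and far to the right, which are
   close to the two periodic points. *)
Lemma switch_point_shift_sep (d : int) : d != 0 ->
  ~ R z0 (shift_by d z0).
Proof.
move=> d0 Rd.
have [m msep] := R_sep (periodic_point_markov A_walk)
  (periodic_point_markov B_walk) AB_sep.
have Rk (k : nat) : R z0 (shift_by (k.+1%:Z * d) z0).
  elim: k => [|k IH]; first by rewrite mul1r.
  apply: R_trans IH _; have := R_shift (k.+1%:Z * d) Rd.
  suff -> : shift_by (k.+1%:Z * d) (shift_by d z0) =
    shift_by (k.+2%:Z * d) z0 by [].
  by apply/funext => n; rewrite /shift_by; congr (z0 _); lia.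
(* The factor [L] makes the translation [k.+1 * d] preserve the phase of both periodic halves; the
   factor m + 1 makes it longer than the window [m]. *)
pose k := ((m + 1) * L).-1; have kE : k.+1 = ((m + 1) * L)%N by rewrite /k; nia.
have dm (e : int) : `|e| = `|k.+1%:Z * d| -> m%:Z < `|e|.
  by move=> ->; rewrite normrM kE; move: d0; nia.
have eR (e : int) : `|e| = `|k.+1%:Z * d| -> R z0 (shift_by e z0).
  move=> eE; have [->|->] : e = k.+1%:Z * d \/ e = - (k.+1%:Z * d) by lia.
    exact: Rk.
  have := R_shift (- (k.+1%:Z * d)) (Rk k) => /R_sym.
  suff -> : shift_by (- (k.+1%:Z * d)) (shift_by (k.+1%:Z * d) z0) =
    z0 by [].
  by apply/funext => n; rewrite /shift_by; congr (z0 _); lia.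
pose e := `|k.+1%:Z * d|; have em : m%:Z < e by have := dm e; rewrite /e normr_id; exact.
have emod (n : int) : ((n + e) %% L%:Z)%Z = (n %% L%:Z)%Z /\
    ((n - e) %% L%:Z)%Z = (n %% L%:Z)%Z.
  have -> : e = (m%:Z + 1) * `|d| * L%:Z by rewrite /e normrM kE; nia.
  by rewrite -mulNr ![n + _]addrC !modzMDl.
apply: (msep (shift_by (- e) z0) (shift_by e z0)).
- move=> n nm; rewrite /shift_by /switch_point /periodic_point.
  have -> : n - e < 0 by lia.
  by rewrite (emod n).2.
- move=> n nm; rewrite /shift_by /switch_point /periodic_point.
  have -> : (n + e < 0) = false by lia.
  by rewrite (emod n).1.
- apply: (R_trans (y := z0)); first apply: R_sym.
    by apply: eR; rewrite normrN normr_id.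
  by apply: eR; rewrite normr_id.
Qed.

(** Every single offset has its own window by [R_sep], and only finitely many offsets are at most
    [D]. The common window decides how often [A] and [B] are repeated in the marker. *)
Lemma switch_point_sep (D : nat) : exists m : nat, forall (d : int) x y,
  d != 0 -> `|d| <= D%:Z -> agree m x z0 ->
  agree m y (shift_by d z0) -> ~ R x y.
Proof.
have shiftM d : markov_point E (shift_by d z0).
  by move=> n; rewrite /shift_by addrAC; exact: switch_point_markov.
have sepd (d : int) : exists m, d != 0 -> forall x y,
    agree m x z0 -> agree m y (shift_by d z0) -> ~ R x y.
  have [->|d0] := eqVneq d 0; first by exists 0%N.
  have [m mP] := R_sep switch_point_markov (shiftM d) (switch_point_shift_sep d0).
  by exists m.
elim: D => [|D [m IH]]; first by exists 0%N => d x y; lia.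
have [m1 m1P] := sepd D.+1%:Z; have [m2 m2P] := sepd (- D.+1%:Z).
exists (m + m1 + m2)%N => d x y d0 dD xz yz.
have sub m' : (m' <= m + m1 + m2)%N ->
    agree m' x z0 /\ agree m' y (shift_by d z0).
  by move=> h; split=> n nm; [apply: xz|apply: yz]; lia.
have [dD'|dD'] := leP `|d| D%:Z.
  by have [] := sub m ltac:(lia); exact: IH.
have [de|de] : d = D.+1%:Z \/ d = - D.+1%:Z by lia.
  by have [] := sub m1 ltac:(lia); rewrite de; apply: m1P; lia.
by have [] := sub m2 ltac:(lia); rewrite de; apply: m2P; lia.
Qed.

End marker_separation.

(** * The topology of Markov shifts *)

Section sequence_topology.
Variable V : countType.
Notation seqs := {ptws int -> discrete_topology V}.

Lemma nbhs_agree (x : seqs) m : nbhs x [set y : seqs | agree m (y : int -> V) x].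
Proof.
have coord n : nbhs x [set y : seqs | y n = x n :> V].
  apply: (@proj_continuous int (fun=> discrete_topology V) n x [set x n]).
  exact: discrete_set1.
elim: m => [|m IH].
  by apply: filterS (coord 0) => y /= y0 n n0; have -> : n = 0 by lia.
apply: filterS (filterI IH (filterI (coord m.+1%:Z) (coord (- m.+1%:Z)))).
move=> y [/= ym [y1 y2]] n nm.
have [|[->|->]] : `|n| <= m%:Z \/ n = m.+1%:Z \/ n = - m.+1%:Z by lia.
- exact: ym.
- exact: y1.
- exact: y2.
Qed.

Lemma ptws_nbhsP (x : seqs) (A : set seqs) :
  nbhs x A <-> exists m, forall y : seqs, agree m (y : int -> V) x -> A y.
Proof.
split=> [|[m mA]]; last exact: filterS (nbhs_agree x m).
(* The topology is a supremum of coordinate topologies, so convergence of the filter generated by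
   the cylinders around [x] can be checked coordinate by coordinate. *)
pose F : set_system seqs :=
  [set B | exists m, forall y : seqs, agree m (y : int -> V) x -> B y].
have FF : Filter F.
  split; first by exists 0%N.
  - move=> B C [m mB] [k kC]; exists (m + k)%N => y yx.
    by split; [apply: mB|apply: kC] => n nm; apply: yx; lia.
  - by move=> B C BC [m mB]; exists m => y /mB /BC.
suff : F --> x by apply.
apply/cvg_sup => n; apply/cvg_image.
  by rewrite predeqE => a; split=> // _; exists (fun=> a).
move=> B /= Bx; exists [set y : seqs | B (y n)].
  exists (absz n) => y yx /=; rewrite [y n]yx ?abszE //.
  exact: nbhs_singleton.
by rewrite predeqE => a; split=> [[y By <-] //|Ba]; exists (fun=> a).
Qed.

Lemma ptws_hausdorff : hausdorff_space seqs.
Proof.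
move=> x y cxy; apply/funext => n; apply: contrapT => xy.
have [z [/= zx zy]] := cxy _ _ (nbhs_agree x (absz n)) (nbhs_agree y (absz n)).
by apply: xy; rewrite -[x n]zx -?[y n]zy ?abszE.
Qed.

End sequence_topology.

Section subtype_nbhs.
Variables (X : topologicalType) (A : set X).

Lemma subtype_nbhsP (x : A) (B : set A) :
  nbhs x B <-> exists2 C, nbhs (set_val x) C & set_val @^-1` C `<=` B.
Proof.
split=> [[_ [[W oW <-] Wx WB]]|[C]].
  by exists W => //; apply: open_nbhs_nbhs.
rewrite nbhsE => -[W [oW Wx] WC] CB.
by exists (set_val @^-1` W); split=> [|//|y /= /WC/CB //]; exists W.
Qed.

Lemma subtype_hausdorff : hausdorff_space X -> hausdorff_space A.
Proof.
move=> hX x y cxy; apply: val_inj; apply: hX => B C xB yC.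
have [||z [/= Bz Cz]] := cxy (set_val @^-1` B) (set_val @^-1` C).
- by apply/subtype_nbhsP; exists B.
- by apply/subtype_nbhsP; exists C.
- by exists (set_val z).
Qed.

End subtype_nbhs.

Section markov_topology.
Variables (V : countType) (E : rel V).

Definition coords (x : markov_shift E) : int -> V := set_val x.

Lemma coords_markov x : markov_point E (coords x).
Proof. exact: (set_valP x). Qed.

Lemma coords_inj : injective coords.
Proof. by move=> x y xy; apply: val_inj. Qed.

Lemma coords_exists (u : int -> V) : markov_point E u ->
  exists x, coords x = u.
Proof. by move=> Eu; exists (exist _ u (mem_set Eu)). Qed.

Lemma coords_shift x : coords (markov_map E x) = shift_by 1 (coords x).
Proof. by []. Qed.

Lemma markov_nbhsP (x : markov_shift E) (B : set (markov_shift E)) :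
  nbhs x B <-> exists m, forall y, agree m (coords y) (coords x) -> B y.
Proof.
split=> [/subtype_nbhsP[C /ptws_nbhsP[m mC] CB]|[m mB]].
  by exists m => y yx; apply/CB/mC.
apply/subtype_nbhsP; exists [set y | agree m (y : int -> V) (coords x)].
  exact: nbhs_agree.
by move=> y; exact: mB.
Qed.

Lemma markov_hausdorff : hausdorff_space (markov_shift E).
Proof. exact/subtype_hausdorff/ptws_hausdorff. Qed.

Lemma nbhs_agree_coords (x : markov_shift E) m :
  nbhs x [set y | agree m (coords y) (coords x)].
Proof. by apply/markov_nbhsP; exists m. Qed.

End markov_topology.

Lemma continuous_markov (X : topologicalType) (V : countType) (E : rel V)
    (g : X -> markov_shift E) :
  continuous g <->
  forall x n, nbhs x [set y | coords (g y) n = coords (g x) n].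
Proof.
split=> [cg x n|cg x B /markov_nbhsP[m mB]].
  apply: (cg x [set z | coords z n = coords (g x) n]).
  by apply/markov_nbhsP; exists (absz n) => y; apply; lia.
suff : nbhs x [set y | agree m (coords (g y)) (coords (g x))].
  by apply: filterS => y; exact: mB.
elim: m {mB} => [|m IH].
  by apply: filterS (cg x 0) => y /= y0 n n0; have -> : n = 0 by lia.
apply: filterS (filterI IH (filterI (cg x m.+1%:Z) (cg x (- m.+1%:Z)))).
move=> y [/= ym [y1 y2]] n nm.
have [|[->|->]] : `|n| <= m%:Z \/ n = m.+1%:Z \/ n = - m.+1%:Z by lia.
- exact: ym.
- exact: y1.
- exact: y2.
Qed.

(** A cluster point exists in the full shift by Tychonoff's theorem. It satisfies the edge
    conditions because each of them involves only two coordinates. *)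
Lemma finite_markov_compact (W : finType) (F : rel W) :
  compact [set: markov_shift F].
Proof.
have cT : compact [set: {ptws int -> discrete_topology W}].
  have := @tychonoff int (fun=> discrete_topology W) (fun=> setT).
  have -> : [set f : int -> discrete_topology W |
    forall i, [set: discrete_topology W] (f i)] = setT by apply/seteqP.
  by apply=> _; apply: finite_compact; exact: finite_finset.
move=> G PG _.
have [u [_ ucl]] := cT (set_val @ G) _ filterT.
have agr B m : G B -> exists2 y, B y & agree m (coords y) u.
  move=> GB; have GvB : (set_val @ G) (set_val @` B).
    by apply: (@filterS _ G _ B _ _ GB) => y By; exists y.
  by have [_ [[y By <-] yu]] := ucl _ _ GvB (nbhs_agree u m); exists y.
have Eu : markov_point F u.
  move=> n; have [y _ yu] := agr setT (absz n).+1 filterT.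
  by rewrite -!yu; [exact: coords_markov|lia|lia].
have [x xu] := coords_exists Eu.
exists x; split=> // B C GB /markov_nbhsP[m mC].
have [y By yu] := agr B m GB.
by exists y; split=> //; apply: mC; rewrite xu.
Qed.

(* The injection maps closed sets to compact, hence closed, sets. *)
Lemma compact_injection_homeomorphism (X Z : topologicalType) (g : X -> Z) :
  compact [set: X] -> hausdorff_space Z -> continuous g -> injective g ->
  exists g' : X -> range g, homeomorphism g' /\ forall x, set_val (g' x) = g x.
Proof.
move=> cX hZ cg ig.
have rg x : g x \in range g by apply/mem_set; exists x.
pose g' x : range g := exist _ (g x) (rg x).
have inv z : exists x, g' x = z.
  by have [x _ xz] := set_valP z; exists x; apply: val_inj.
have /choice[k kP] := inv.
exists g'; split=> //; split.
  move=> x B /subtype_nbhsP[C xC CB].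
  have gC : nbhs x (g @^-1` C) by exact: cg.
  by apply: filterS gC => y; exact: (CB (g' y)).
exists k; split.
- have kc (C : set X) : closed C -> closed (k @^-1` C).
    move=> cC; have cgC : closed (g @` C).
      apply: compact_closed => //; apply: continuous_compact.
        exact: continuous_subspaceT.
      exact: (subclosed_compact cC cX).
    have -> : k @^-1` C = set_val @^-1` (g @` C).
      apply/seteqP; split=> z /=.
        by move=> Cz; exists (k z) => //; rewrite -[in RHS](kP z).
      move=> [x Cx xz]; have -> : k z = x; last by [].
      by apply: ig; have /(congr1 set_val) := kP z; rewrite /= -xz.
    apply: closed_comp cgC => z _; exact: initial_continuous.
  apply/continuousP => B oB; rewrite -[B]setCK preimage_setC openC.
  exact: (kc _ (open_closedC oB)).
- by move=> x; apply: ig; have /(congr1 set_val) := kP (g' x).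
- exact: kP.
Qed.

(** * Topological entropy *)

(** Fekete's lemma, which makes the [limn] of [cover_entropy] a genuine limit. Since [u 0] is not
    assumed to vanish, it enters the bound along multiples of [m]. *)
Lemma subadditive_cvg (R : realType) (u : nat -> R) :
  (forall n, 0 <= u n) -> (forall m n, u (m + n)%N <= u m + u n) ->
  cvgn (fun n => u n / n%:R).
Proof.
move=> u0 uD.
pose S := [set x | exists2 m, (0 < m)%N & x = u m / m%:R].
have S0 : has_inf S.
  split; first by exists (u 1%N / 1%:R), 1%N.
  by exists 0 => _ [m _ ->]; rewrite divr_ge0.
suff : (fun n => u n / n%:R) @ \oo --> inf S by move=> /cvgP.
have l0 : 0 <= inf S by apply: lb_le_inf; [exact: S0.1|move=> _ [m _ ->]; rewrite divr_ge0].
have uM q m : u (q * m)%N <= q%:R * u m + u 0%N.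
  elim: q => [|q IH]; first by rewrite mul0n mul0r add0r.
  by rewrite mulSn; apply: (le_trans (uD _ _)); rewrite -natr1; lra.
apply/cvgrPdist_le => e e0.
have [_ [m m0 ->] me] := inf_adherent (divr_gt0 e0 (ltr0n R 2)) S0.
pose M := \sum_(r < m) u r + u 0%N.
have M0 : 0 <= M by rewrite addr_ge0 // sumr_ge0.
near=> n.
have n0 : (0 < n)%N by near: n; exists 1%N.
have n0R : 0 < n%:R :> R by rewrite ltr0n.
have lo : inf S <= u n / n%:R by apply: ge_inf; [exact: S0.2|exists n].
rewrite distrC ger0_norm ?subr_ge0 // lerBlDl ler_pdivrMr //.
have un : u n <= (n %/ m)%:R * u m + M.
  rewrite {1}(divn_eq n m); apply: (le_trans (uD _ _)).
  have rM : u (n %% m)%N <= \sum_(r < m) u r.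
    have rm : (n %% m < m)%N by rewrite ltn_mod.
    rewrite (bigD1 (Ordinal rm)) //= lerDl; exact: sumr_ge0.
  by have := uM (n %/ m)%N m; rewrite /M; lra.
apply: (le_trans un).
have Mn : M <= e / 2 * n%:R.
  rewrite -ler_pdivrMl ?divr_gt0 //; near: n; exact: nbhs_infty_ger.
have um : (n %/ m)%:R * u m <= (inf S + e / 2) * n%:R.
  have mR : 0 < m%:R :> R by rewrite ltr0n.
  have um : u m <= (inf S + e / 2) * m%:R by rewrite -ler_pdivrMr //; exact: ltW.
  apply: (le_trans (ler_wpM2l (ler0n _ _) um)).
  rewrite mulrCA ler_wpM2l //; first by rewrite addr_ge0 // divr_ge0 // ltW.
  by rewrite -natrM ler_nat leq_trunc_div.
by apply: (le_trans (lerD um Mn)); lra.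
Unshelve. all: by end_near.
Qed.

Section cover_numbers.
Variables (R : realType) (X : topologicalType).
Implicit Types (U : set (set X)) (f : X -> X).

Definition subcover_card U (k : nat) : Prop :=
  exists F : 'I_k -> set X, (forall i, U (F i)) /\ \bigcup_i F i = [set: X].

Lemma subcover_card_fin U (T : finType) (F : T -> set X) :
  (forall t, U (F t)) -> (forall x, exists t, F t x) -> subcover_card U #|T|.
Proof.
move=> UF Fx; exists (F \o enum_val); split=> [i|]; first exact: UF.
apply/seteqP; split=> // x _; have [t Ftx] := Fx x.
by exists (enum_rank t) => //=; rewrite enum_rankK.
Qed.

Lemma cover_number_le U k : subcover_card U k -> cover_number R U <= k%:R.
Proof.
move=> [F [UF cF]]; apply: ge_inf; last by exists k, F.
by exists 0 => _ [l [G [_ _ ->]]].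
Qed.

Lemma cover_number_attained U : (exists k, subcover_card U k) ->
  exists2 k, subcover_card U k & cover_number R U = k%:R.
Proof.
move=> exk.
have exk' : exists k, `[< subcover_card U k >].
  by have [k kU] := exk; exists k; exact/asboolP.
case: (ex_minnP exk') => k /asboolP kU kmin; exists k => //.
apply/eqP; rewrite eq_le cover_number_le //=.
apply: lb_le_inf; first by have [F [UF cF]] := kU; exists k%:R, k, F.
move=> _ [l [G [UG cG ->]]]; rewrite ler_nat; apply: kmin; apply/asboolP.
by exists G.
Qed.

Lemma cover_number_ge U (T : finType) (z : T -> X) :
  (exists k, subcover_card U k) ->
  (forall A s t, U A -> A (z s) -> A (z t) -> s = t) ->
  #|T|%:R <= cover_number R U.
Proof.
move=> /cover_number_attained[k [F [UF cF]] ->] zU; rewrite ler_nat.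
have /choice[g gP] : forall t, exists i, F i (z t).
  by move=> t; have : [set: X] (z t) by []; rewrite -cF => -[i _ ?]; exists i.
rewrite -[leqRHS]card_ord; apply: (@leq_card _ _ g) => s t gst.
by apply: zU (UF (g s)) (gP s) _; rewrite gst.
Qed.

Lemma join_coverD f U m n k l : subcover_card (join_cover f U m) k ->
  subcover_card (join_cover f U n) l ->
  subcover_card (join_cover f U (m + n)) (k * l).
Proof.
move=> [F [UF cF]] [G [UG cG]].
have := @subcover_card_fin (join_cover f U (m + n)) ('I_k * 'I_l)%type
  (fun t => F t.1 `&` (iter m f @^-1` G t.2)).
rewrite card_prod !card_ord; apply.
  move=> [i j] /=; have [A [UA ->]] := UF i; have [B [UB ->]] := UG j.
  exists (fun s => match fintype.split s with inl a => A a | inr b => B b end).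
  split; first by move=> s; case: fintype.split.
  apply/seteqP; split=> [x [Ax Bx] s _ /=|x ABx].
    case: splitP => a ->; first exact: Ax.
    by rewrite addnC iterD; exact: (Bx a).
  split=> [a _ /=|b _ /=].
    have := ABx (lshift n a) I => /=.
    by case: splitP => b /= e; [rewrite (ord_inj e)|have := ltn_ord a; lia].
  have := ABx (rshift m b) I => /=.
  case: splitP => a /= e; first by have := ltn_ord a; lia.
  by rewrite addnC iterD; have -> : b = a by apply: ord_inj; lia.
move=> x; have : [set: X] x by []; rewrite -cF => -[i _ Fx].
have : [set: X] (iter m f x) by []; rewrite -cG => -[j _ Gx].
by exists (i, j).
Qed.

(** For the cover by the level sets of [c], points with different itineraries never share a member
    of the joined cover, so k * l steps require at least #|T|^k members. As the limit exists, it can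
    be taken along the multiples of [l]. *)
Lemma topological_entropy_ge f (W T : finType) (c : X -> W) (l : nat) :
  (0 < l)%N -> (0 < #|T|)%N -> (forall w, open (c @^-1` [set w])) ->
  (forall k, exists z : {ffun 'I_k -> T} -> X, forall s t,
    (forall i, (i < k * l)%N -> c (iter i f (z s)) = c (iter i f (z t))) ->
    s = t) ->
  ((ln (#|T|%:R : R) / l%:R)%:E <= topological_entropy R f)%E.
Proof.
move=> l0 T0 oc sepz; pose U := [set c @^-1` [set w] | w in [set: W]].
have oU : open_cover U.
  split; first by move=> _ [w _ <-].
  by apply/seteqP; split=> // x _; exists (c @^-1` [set c x]) => //; exists (c x).
apply: (@le_trans _ _ (cover_entropy R f U)%:E); last first.
  by apply: ereal_sup_ubound; exists U.
rewrite lee_fin /cover_entropy.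
pose N n : R := cover_number R (join_cover f U n).
have fin1 : exists k, subcover_card (join_cover f U 1) k.
  exists #|W|; apply: (@subcover_card_fin _ _ (fun w => c @^-1` [set w])).
    move=> w; exists (fun=> c @^-1` [set w]); split; first by move=> _; exists w.
    apply/seteqP; split=> [x xw [[|//] i0] _ //|x xw].
    exact: (xw ord0 I).
  by move=> x; exists (c x).
have fin n : exists k, subcover_card (join_cover f U n) k.
  elim: n => [|n [k kU]].
    exists 1%N, (fun=> setT); split=> [_|].
      exists (fun=> setT); split; first by case.
      by apply/seteqP; split=> // x _ [].
    by apply/seteqP; split=> // x _; exists ord0.
  by have [j jU] := fin1; exists (j * k)%N; exact: (@join_coverD f U 1 n).
have [x0] : exists x : X, True.
  by have /card_gt0P[t _] := T0; have [z _] := sepz 0%N; exists (z [ffun=> t]).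
move=> _; have N1 n : 1 <= N n.
  have := @cover_number_ge (join_cover f U n) unit (fun=> x0) (fin n).
  by rewrite card_unit; apply=> A [] [].
have NM m n : N (m + n)%N <= N m * N n.
  have [k kU kE] := cover_number_attained (fin m).
  have [j jU jE] := cover_number_attained (fin n).
  by rewrite /N kE jE -natrM; apply/cover_number_le/join_coverD.
have Nk k : (#|T|%:R : R) ^+ k <= N (k * l)%N.
  have [z zP] := sepz k.
  have := @cover_number_ge (join_cover f U (k * l)) _ z (fin _).
  rewrite card_ffun card_ord natrX; apply=> _ s t [F [UF ->]] sF tF.
  apply: zP => i ikl; have := sF (Ordinal ikl) I; have := tF (Ordinal ikl) I.
  by have [w _ <-] := UF (Ordinal ikl) => /= -> ->.
have cv : cvgn (fun n => ln (N n) / n%:R).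
  apply: subadditive_cvg => [n|m n]; first exact: ln_ge0.
  rewrite -lnM ?posrE ?(lt_le_trans ltr01) //.
  by rewrite ler_ln ?posrE ?mulr_gt0 ?(lt_le_trans ltr01).
have T1 : 0 < #|T|%:R :> R by rewrite ltr0n.
have cv2 : (fun k => ln (N (k.+1 * l)%N) / (k.+1 * l)%:R) @ \oo -->
    limn (fun n => ln (N n) / n%:R).
  apply: (@cvg_comp _ _ _ (fun k => k.+1 * l)%N (fun n => ln (N n) / n%:R) \oo \oo).
    by apply/cvgnyPge => A; exists A => // k /= Ak; nia.
  exact: cv.
rewrite -(cvg_lim _ cv2) //.
apply: limr_ge; first by apply/cvg_ex; eexists; exact: cv2.
near=> k; rewrite natrM ler_pdivlMr ?mulr_gt0 ?ltr0n //.
have lR : l%:R != 0 :> R by rewrite pnatr_eq0 -lt0n.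
rewrite mulrCA divfK // mulr_natl -lnXn //.
have N0 : 0 < N (k.+1 * l)%N := lt_le_trans ltr01 (N1 _).
by rewrite ler_ln ?posrE ?exprn_gt0 ?Nk.
Unshelve. all: by end_near.
Qed.

End cover_numbers.

(** * Coded systems *)

Section coded_system.
Variables (X Y : topologicalType) (f : X -> X) (T : Y -> Y) (pi : X -> Y).
Variables (V : countType) (E : rel V) (phi : X -> markov_shift E).
Hypotheses (phi_homeo : homeomorphism phi)
  (phi_f : forall x, phi (f x) = markov_map E (phi x)).

Definition code (x : X) : int -> V := coords (phi x).

Lemma code_markov x : markov_point E (code x).
Proof. exact: coords_markov. Qed.

Lemma code_inj : injective code.
Proof.
have [_ [g [_ phiK _]]] := phi_homeo.
by move=> x y /coords_inj xy; rewrite -(phiK x) xy phiK.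
Qed.

Lemma code_exists u : markov_point E u -> exists x, code x = u.
Proof.
have [_ [g [_ _ gK]]] := phi_homeo.
by move=> /coords_exists[z zu]; exists (g z); rewrite /code gK.
Qed.

Lemma code_iter n x : code (iter n f x) = shift_by n%:Z (code x).
Proof.
elim: n => [|n IH]; first by apply/funext => k; rewrite /shift_by addr0.
rewrite iterS /code phi_f coords_shift -/(code _) IH.
by apply/funext => k; rewrite /shift_by; congr code; lia.
Qed.

Lemma code_nbhsP x (B : set X) :
  nbhs x B <-> exists m, forall y, agree m (code y) (code x) -> B y.
Proof.
have [cphi [g [cg phiK gK]]] := phi_homeo; split=> [xB|[m mB]].
  have : nbhs (phi x) (g @^-1` B) by apply: cg; rewrite phiK.
  move=> /markov_nbhsP[m mB]; exists m => y /mB; by rewrite /= phiK.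
have pB : nbhs x (phi @^-1` [set y | agree m (coords y) (coords (phi x))]).
  by apply: cphi; exact: nbhs_agree_coords.
by apply: filterS pB => y; exact: mB.
Qed.

(** Equality of images, transported to label sequences, where words can be compared. A sequence that
    is not the code of a point is related to nothing. *)
Definition fiber_rel (u w : int -> V) : Prop :=
  exists x y, [/\ code x = u, code y = w & pi x = pi y].

Lemma fiber_relP x y : fiber_rel (code x) (code y) <-> pi x = pi y.
Proof.
split=> [[x' [y' [/code_inj -> /code_inj -> //]]]|xy].
by exists x, y.
Qed.

Lemma fiber_rel_sym u w : fiber_rel u w -> fiber_rel w u.
Proof. by move=> [x [y [xu yw xy]]]; exists y, x. Qed.

Lemma fiber_rel_trans u w z : fiber_rel u w -> fiber_rel w z -> fiber_rel u z.
Proof.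
move=> [x [y [<- <- xy]]] [y' [t [/code_inj -> <- yt]]].
by apply/fiber_relP; rewrite xy.
Qed.

Hypotheses (T_inj : injective T) (pi_f : forall x, pi (f x) = T (pi x)).

Lemma pi_iter n x : pi (iter n f x) = iter n T (pi x).
Proof. by elim: n => //= n IH; rewrite pi_f IH. Qed.

(** Forward shifts follow from the factor relation. For a backward shift, the translated points are
    brought back by iterating [f], and injectivity of [T] cancels the iterates on the images. *)
Lemma fiber_rel_shift u w (d : int) :
  fiber_rel u w -> fiber_rel (shift_by d u) (shift_by d w).
Proof.
have pos (n : nat) x y : pi x = pi y -> pi (iter n f x) = pi (iter n f y).
  by move=> xy; rewrite !pi_iter xy.
move=> [x [y [<- <- xy]]]; case: d => n.
  by rewrite -!code_iter; apply/fiber_relP/pos.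
have [x' x'E] : exists x', code x' = shift_by (Negz n) (code x).
  by apply: code_exists => k; rewrite /shift_by addrAC; exact: code_markov.
have [y' y'E] : exists y', code y' = shift_by (Negz n) (code y).
  by apply: code_exists => k; rewrite /shift_by addrAC; exact: code_markov.
have back z z' : code z' = shift_by (Negz n) (code z) -> iter n.+1 f z' = z.
  move=> e; apply: code_inj; rewrite code_iter e.
  by apply/funext => k; rewrite /shift_by; congr code; lia.
rewrite -x'E -y'E; apply/fiber_relP.
have iT_inj : injective (iter n.+1 T).
  by elim: n.+1 => //= k IH a b /T_inj /IH.
by apply: iT_inj; rewrite -!pi_iter (back _ _ x'E) (back _ _ y'E).
Qed.

Hypotheses (cpi : continuous pi) (hY : hausdorff_space Y).

(** Distinct images have disjoint open neighbourhoods, whose preimages contain cylinders by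
    continuity of [pi]. *)
Lemma fiber_rel_sep u w : markov_point E u -> markov_point E w ->
  ~ fiber_rel u w ->
  exists m, forall u' w', agree m u' u -> agree m w' w -> ~ fiber_rel u' w'.
Proof.
move=> /code_exists[x <-] /code_exists[y <-] /fiber_relP nxy.
have [[A B] /= [/set_mem xA /set_mem yB] [/= oA oB AB]] :
    exists2 AB : set Y * set Y, pi x \in AB.1 /\ pi y \in AB.2 &
      [/\ open AB.1, open AB.2 & AB.1 `&` AB.2 == set0].
  by move: hY; rewrite open_hausdorff; apply; apply/eqP.
have [m1 m1P] : exists m, forall y, agree m (code y) (code x) -> A (pi y).
  by apply/code_nbhsP/cpi; exact: open_nbhs_nbhs.
have [m2 m2P] : exists m, forall z, agree m (code z) (code y) -> B (pi z).
  by apply/code_nbhsP/cpi; exact: open_nbhs_nbhs.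
exists (m1 + m2)%N => u' w' ux wy [x' [y' [x'u y'w xy]]].
have Ax : A (pi x') by apply: m1P => n nm; rewrite x'u; apply: ux; lia.
have By : B (pi y') by apply: m2P => n nm; rewrite y'w; apply: wy; lia.
have : (A `&` B) (pi x') by split=> //; rewrite xy.
by move/eqP: AB => ->.
Qed.

End coded_system.

(** * The horseshoe *)

(** Negative times reuse the sequence [b] through [absz]; the entropy count looks only at
    nonnegative times. *)
Lemma constant_height_walk (B : finType) (len : B -> nat) (l : nat) (b : nat -> B) :
  (0 < l)%N -> (forall j, len (b j) = l) ->
  exists w : int -> tower len, (forall n, tower_edge (w n) (w (n + 1))) /\
    forall n, tower_base (w n) = b (absz (n %/ l%:Z)%Z) /\
              tower_level (w n) = absz (n %% l%:Z)%Z.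
Proof.
move=> l0 bl.
have /choice[w wP] : forall n : int, exists x : tower len,
    tower_base x = b (absz (n %/ l%:Z)%Z) /\ tower_level x = absz (n %% l%:Z)%Z.
  by move=> n; apply: tower_exists; rewrite bl; exact: absz_mod_lt.
exists w; split=> // n; have [bn ln] := wP n; have [bn1 ln1] := wP (n + 1).
rewrite /tower_edge bn ln bn1 ln1 bl absz_modS //.
case: eqP => [_ //|ne]; rewrite eqxx andbT; apply/eqP; congr (b (absz _)).
have := absz_mod_lt n l0; have := divz_eq n l%:Z.
have rE : (n %% l%:Z)%Z = (absz (n %% l%:Z)%Z)%:Z.
  by rewrite gez0_abs // modz_ge0 //; lia.
rewrite rE absz_nat in ne *; move: (absz _) ne => r ne nE rl.
have small : ((r%:Z + 1) %/ l%:Z)%Z = 0 by rewrite divz_small //; lia.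
by rewrite {1}nE -addrA divzMDl ?small ?addr0 //; lia.
Qed.

Section horseshoe.
Variables (R : realType) (X Y : topologicalType).
Variables (f : X -> X) (T : Y -> Y) (pi : X -> Y).
Variables (V : countType) (E : rel V) (phi : X -> markov_shift E).
Hypotheses (phi_homeo : homeomorphism phi)
  (phi_f : forall x, phi (f x) = markov_map E (phi x)).
Hypotheses (T_inj : injective T) (pi_f : forall x, pi (f x) = T (pi x)).
Hypotheses (cpi : continuous pi) (hX : hausdorff_space X) (hY : hausdorff_space Y).
Variables (p : nat) (E_conn : strongly_connected E) (E_per : graph_period E p).
Variables (v : V) (L : nat) (A : nat -> V) (I : finType) (beta : I -> nat -> V).
Hypotheses (L_gt0 : (0 < L)%N) (A_walk : walk_word E v v L A)
  (beta_walk : forall i, walk_word E v v L (beta i)).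
Notation rel_pi := (fiber_rel pi phi).
Hypothesis aligned_sep : forall i j x y, i != j ->
  (forall l : nat, (l < L)%N -> x l%:Z = beta i l) ->
  (forall l : nat, (l < L)%N -> y l%:Z = beta j l) -> ~ rel_pi x y.
Hypothesis run_sep : forall i t x y,
  (forall l : nat, (l < L)%N -> x l%:Z = beta i l) ->
  (forall l : nat, (l < L)%N -> y l%:Z = A ((t + l) %% L)%N) -> ~ rel_pi x y.
Variable h : R.
Hypotheses (h_ge0 : 0 <= h) (h_lt : h * L%:R < ln #|I|%:R).

Lemma horseshoe_coding : exists (K r lQ : nat) (Q : nat -> V) (i0 : I),
  let len := @superblock_len I L K r lQ in
  [/\ (0 < lQ)%N /\ (0 < K)%N, walk_word E v v lQ Q,
      forall w w' : int -> tower len,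
        (forall n, tower_edge (w n) (w (n + 1))) ->
        (forall n, tower_edge (w' n) (w' (n + 1))) ->
        rel_pi (fun n => tower_label A Q beta i0 (w n))
               (fun n => tower_label A Q beta i0 (w' n)) -> w = w',
      graph_period (@tower_edge _ len) p &
      h * ((r + r + K) * L)%:R < K%:R * ln #|I|%:R] /\ (4 <= r)%N.
Proof.
have lnI : 0 < ln (#|I|%:R : R) by apply: le_lt_trans h_lt; rewrite mulr_ge0.
have I0 : (0 < #|I|)%N.
  by rewrite lt0n; apply: contraTneq lnI => ->; rewrite ln0 // ltxx.
have /card_gt0P[i0 _] := I0.
have pL := period_dvdn_closed_walk E_per A_walk.
have p0 : (0 < p)%N by rewrite lt0n; apply: contraTneq pL => ->; rewrite dvd0n; lia.
have [a [Q Qw]] : exists l, closed_length E v (l * L + p)%N.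
  by apply: closed_length_period => //; exists A.
set lQ := (a * L + p)%N in Qw; have lQ0 : (0 < lQ)%N by rewrite /lQ; lia.
have pQ := period_dvdn_closed_walk E_per Qw.
pose D := (2 * L + lQ)%N.
have AB : ~ rel_pi (periodic_point L A) (periodic_point L (beta i0)).
  move=> /fiber_rel_sym; apply: (run_sep (i := i0) (t := 0%N)) => l lL.
    by rewrite /periodic_point modz_nat absz_nat modn_small.
  by rewrite /periodic_point modz_nat absz_nat add0n.
have [m mP] := switch_point_sep L_gt0 A_walk (beta_walk i0) (@fiber_rel_sym _ _ pi _ _ phi)
  (fiber_rel_trans phi_homeo) (fiber_rel_shift phi_homeo phi_f T_inj pi_f)
  (fiber_rel_sep phi_homeo cpi hY) AB D.
(* The half-length [r * L] of the marker must exceed m + D, so that the window [m] still fits after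
   an offset of at most [D]; locating a start needs [r] to be at least 4. *)
pose r := (m + D + 4)%N.
(* The surplus K * (ln #|I| - h * L) of the free loops has to exceed the cost h * (r + r) * L of the
   marker, while [K] keeps the number of blocks congruent to 1 modulo [lQ]. *)
pose c := (2 * r + (Num.truncn (h * ((r + r) * L)%:R / (ln #|I|%:R - h * L%:R))).+1)%N.
pose K := (c * lQ + 1 - (r + r))%N.
have rK : (r + r + K = (c * lQ).+1)%N by rewrite /K /c; nia.
exists K, r, lQ, Q, i0 => len; split; last by rewrite /r; lia.
have rL : (m + D < r * L)%N by rewrite /r; nia.
split=> //.
- by split=> //; rewrite /K /c; nia.
- have r4 : (4 <= r)%N by rewrite /r; lia.
  apply: (marker_coding_inj L_gt0 lQ0 r4 (leqnn D)).
  + exact: fiber_rel_sym.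
  + exact: (fiber_rel_shift phi_homeo phi_f T_inj pi_f).
  + exact: aligned_sep.
  + exact: run_sep.
  + move=> d x y d0 dD xz yz; apply: (mP d) => // n nm.
      by rewrite xz; [|lia].
    by have := yz (n + d); rewrite addrK => -> //; lia.
- apply: tower_graph_period => [b|b|d dl].
  + by apply: superblock_len_gt0 => //; rewrite /r; lia.
  + by rewrite /len /superblock_len dvdn_add ?dvdn_mull //; case: b.1.
  + have d1 := dl (false, [ffun=> i0]); have d2 := dl (true, [ffun=> i0]).
    move: d1 d2; rewrite /len /superblock_len /= addn0 rK => d1.
    rewrite dvdn_addr // => d2.
    by apply: (dvdn_period_superblock d1 d2); exists a.
- have gap : 0 < ln #|I|%:R - h * L%:R by rewrite subr_gt0.
  have cQ : (c <= c * lQ)%N by rewrite leq_pmulr.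
  have := truncnS_gt (h * ((r + r) * L)%:R / (ln #|I|%:R - h * L%:R)).
  set t := Num.truncn _; rewrite ltr_pdivrMr // => ht.
  have tK : t.+1%:R <= K%:R :> R by rewrite ler_nat; move: cQ; rewrite /K /c -/t; lia.
  have {tK} := ler_wpM2r (ltW gap) tK; move: ht.
  by rewrite (mulnDl (r + r) K L) natrD (natrM _ K); lra.
Qed.


Lemma horseshoe_subshift : exists (X' : set X) (X'f : invariant_set f X'),
  [/\ shift_of_finite_type (restrict_map X'f),
      irreducible_markov (restrict_map X'f) p,
      (h%:E < topological_entropy R (restrict_map X'f))%E &
      set_inj X' pi].
Proof.
have [K [r [lQ [Q [i0 /=]]]]] := horseshoe_coding.
set len := @superblock_len I L K r lQ.
move=> [[[lQ0 K0] Qw winj per hK] r4].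
have r0 : (0 < r)%N by lia.
have len0 b : (0 < len b)%N by apply: superblock_len_gt0.
pose F : rel (tower len) := @tower_edge _ len.
pose Sg : topologicalType := markov_shift F.
pose read (w : Sg) : int -> V := fun n => tower_label A Q beta i0 (coords w n).
have readM w : markov_point E (read w).
  move=> n; apply: (tower_label_edge (E := E) (v := v)) => //.
  exact: (coords_markov w n).
have /choice[psi psiP] w : exists x, code phi x = read w.
  exact: (code_exists phi_homeo (readM w)).
have cpsi : continuous psi.
  have [_ [g [cg phiK gK]]] := phi_homeo.
  have -> : psi = g \o (phi \o psi) by apply/funext => w /=; rewrite phiK.
  move=> w; apply: continuous_comp; last exact: cg.
  move: w; apply/continuous_markov => w n.
  apply: filterS (nbhs_agree_coords w (absz n)) => y /= yw.
  by rewrite -/(code phi _) -/(code phi _) !psiP /read yw //; lia.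
have psi_pi w w' : pi (psi w) = pi (psi w') -> w = w'.
  move=> /(fiber_relP pi phi_homeo); rewrite !psiP => /winj H.
  by apply: coords_inj; apply: H; exact: coords_markov.
have psi_inj : injective psi by move=> w w' e; apply: psi_pi; rewrite e.
have psi_f w : f (psi w) = psi (markov_map F w).
  apply: (code_inj phi_homeo); rewrite (code_iter phi_f 1 (psi w)) !psiP.
  by apply/funext => n; rewrite /shift_by /read.
have X'f : invariant_set f (range psi).
  apply/seteqP; split=> [_ [_ [w _ <-] <-]|_ [w _ <-]].
    by exists (markov_map F w).
  have [w' _ <-] : [set markov_map F w | w in setT] w.
    have [|w' w'E] := @coords_exists _ F (shift_by (- 1) (coords w)).
      by move=> n; rewrite /shift_by addrAC; exact: coords_markov.
    exists w' => //; apply: coords_inj; rewrite coords_shift w'E.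
    by apply/funext => n; rewrite /shift_by addrK.
  by exists (psi w') => //; exists w'.
have cS : compact [set: Sg] by exact: finite_markov_compact.
have [g' [g'h g'P]] := compact_injection_homeomorphism cS hX cpsi psi_inj.
have [cg' [k [ck g'K kK]]] := g'h.
have kh : homeomorphism k by split=> //; exists g'.
have kf x : k (restrict_map X'f x) = markov_map F (k x).
  apply: (can_inj g'K); rewrite kK; apply: val_inj => /=.
  have e : set_val x = psi (k x) by rewrite -g'P kK.
  by rewrite -[RHS]/(set_val _) g'P -psi_f -e.
have conj : conjugate (restrict_map X'f) (markov_map F) by exists k.
exists (range psi), X'f; split.
- by exists (tower len), F.
- by exists (tower len), F; split=> //; exact: (tower_strongly_connected len0).
- have kiter n x : k (iter n (restrict_map X'f) x) = iter n (markov_map F) (k x).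
    by elim: n => //= n IH; rewrite kf IH.
  have siter n (w : Sg) : coords (iter n (markov_map F) w) 0 = coords w n%:Z.
    suff -> : coords (iter n (markov_map F) w) = shift_by n%:Z (coords w).
      by rewrite /shift_by add0r.
    elim: n => [|n IH]; first by apply/funext => j; rewrite /shift_by addr0.
    rewrite iterS coords_shift IH; apply/funext => j.
    by rewrite /shift_by; congr coords; lia.
  set l := ((r + r + K) * L)%N in hK.
  have l0 : (0 < l)%N by rewrite /l; lia.
  have I0 : (0 < #|I|)%N by apply/card_gt0P; exists i0.
  have Tcard : #|{ffun 'I_K -> I}| = (#|I| ^ K)%N by rewrite card_ffun card_ord.
  (* Only superblocks without [Q] are counted: they share the length [l], and the vertex at time
     [a * l] displays the whole choice of free loops made in the superblock of index [a]. *)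
  apply: lt_le_trans (@topological_entropy_ge R _ (restrict_map X'f)
    (tower len) {ffun 'I_K -> I} (fun x => coords (k x) 0) l l0 _ _ _).
  + rewrite lte_fin ltr_pdivlMr ?ltr0n // Tcard natrX lnXn ?ltr0n //.
    by rewrite -[ltRHS]mulr_natl.
  + by rewrite Tcard expn_gt0 I0.
  + move=> w; apply: (@open_comp _ _ k [set z : Sg | coords z 0 = w]).
      by move=> x _; exact: ck.
    rewrite openE => z zw; apply/markov_nbhsP; exists 0%N => y /(_ 0 isT) yz.
    by rewrite /= yz.
  + move=> j.
    pose b (t : {ffun 'I_j -> {ffun 'I_K -> I}}) (s : nat) : superblock I K :=
      (false, oapp t [ffun=> i0] (insub s)).
    have blen t s : len (b t s) = l by rewrite /len /superblock_len /= addn0.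
    have /choice[W WP] t := constant_height_walk l0 (blen t).
    have /choice[z zP] t : exists z : Sg, coords z = W t.
      by apply: coords_exists; have [] := WP t.
    exists (g' \o z) => s t st; apply/ffunP => a.
    have al : (a * l < j * l)%N by rewrite ltn_pmul2r.
    have := st _ al; rewrite !kiter !siter /= !g'K !zP => e.
    have := (WP s).2 (a * l)%N%:Z; have := (WP t).2 (a * l)%N%:Z.
    rewrite PoszM mulzK ?absz_nat; last by rewrite eqz_nat; lia.
    rewrite -PoszM e => -[-> _] [+ _].
    by rewrite /b valK /= => -[].
- move=> x y /set_mem[w _ <-] /set_mem[w' _ <-] /psi_pi ->.
  by [].
Qed.

End horseshoe.

(** * Probability estimates *)

Section real_probability.
Variables (R : realType) (d : measure_display) (X : measurableType d).
Variable mu : probability X R.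

Definition prob (A : set X) : R := fine (mu A).

Lemma probE A : measurable A -> mu A = (prob A)%:E.
Proof. by move=> mA; rewrite fineK // fin_num_measure. Qed.

Lemma prob_ge0 A : 0 <= prob A.
Proof. exact: fine_ge0. Qed.

Lemma prob_le A B : measurable A -> measurable B -> A `<=` B -> prob A <= prob B.
Proof.
by move=> mA mB AB; rewrite -lee_fin -!probE // le_measure // inE.
Qed.

Lemma probT : prob setT = 1.
Proof. by rewrite /prob probability_setT. Qed.

Lemma probU_le A B : measurable A -> measurable B ->
  prob (A `|` B) <= prob A + prob B.
Proof.
move=> mA mB; rewrite -lee_fin EFinD -!probE //; last exact: measurableU.
exact: measureU2.
Qed.

Lemma prob_vanish (F : nat -> set X) (e : R) : (forall n, measurable (F n)) ->
  (forall n, F n.+1 `<=` F n) -> \bigcap_n F n = set0 -> 0 < e ->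
  exists n, prob (F n) <= e.
Proof.
move=> mF dF F0 e0.
have cv : (mu \o F) @ \oo --> mu (\bigcap_n F n).
  apply: nonincreasing_cvg_mu => //.
  - by rewrite (le_lt_trans (probability_le1 mu (mF 0%N))) // ltry.
  - exact: bigcap_measurable.
  - by apply/nonincreasing_seqP => n; apply/subsetPset.
rewrite F0 measure0 in cv.
have := cv _ (open_ereal_lt' (_ : (0 < e%:E)%E)); rewrite lte_fin => /(_ e0).
move=> [n _ /(_ n (leqnn n)) /=]; rewrite probE // lte_fin => /ltW.
by exists n.
Qed.

Lemma prob_bigcup_le (I : finType) (F : I -> set X) (b : I -> R) :
  (forall i, measurable (F i)) -> (forall i, prob (F i) <= b i) ->
  prob (\bigcup_i F i) <= \sum_i b i.
Proof.
move=> mF Fb.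
have -> : \bigcup_i F i = \big[setU/set0]_(i <- index_enum I) F i.
  rewrite -bigcup_seq; apply/seteqP; split=> x [i _ Fx]; exists i => //=.
  by rewrite mem_index_enum.
suff [] : measurable (\big[setU/set0]_(i <- index_enum I) F i) /\
  prob (\big[setU/set0]_(i <- index_enum I) F i) <= \sum_i b i by [].
elim/big_rec2 : _ => [|i r A _ [mA Ar]]; first by rewrite /prob measure0.
split; first exact: measurableU.
by apply: (le_trans (probU_le (mF i) mA)); exact: lerD.
Qed.

Lemma prob_fibers (T : finType) (g : X -> T) (Q : pred T) :
  (forall t, measurable [set x | g x = t]) ->
  measurable [set x | Q (g x)] /\
  prob [set x | Q (g x)] = \sum_(t | Q t) prob [set x | g x = t].
Proof.
move=> mg; rewrite -big_filter.
have -> : [set x | Q (g x)] = [set x | g x \in [seq t <- index_enum T | Q t]].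
  by apply/seteqP; split=> x /=; rewrite mem_filter mem_index_enum andbT.
have : uniq [seq t <- index_enum T | Q t] by rewrite filter_uniq ?index_enum_uniq.
elim: [seq t <- _ | _] => [_|a s IH /= /andP[as' us]].
  have -> : [set x | g x \in [::]] = set0 by apply/seteqP; split.
  by rewrite big_nil /prob measure0.
have [ms ps] := IH us.
have -> : [set x | g x \in a :: s] = [set x | g x = a] `|` [set x | g x \in s].
  apply/seteqP; split=> x /=; rewrite inE.
    by move=> /orP[/eqP|]; [left|right].
  by move=> [->|->]; rewrite ?eqxx ?orbT.
split; first exact: measurableU.
rewrite big_cons -ps /prob measureU //; last first.
  by apply/seteqP; split=> // x [/= ->]; move: as' => /negP.
by rewrite fineD // fin_num_measure.
Qed.

End real_probability.

(** * Inner approximation of Borel sets by closed sets *)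

Section closed_approximation.
Variables (R : realType) (d : measure_display) (X : measurableType d).
Variable mu : probability X R.
Variables (Y : topologicalType) (dist : Y -> Y -> R) (pi : X -> Y).
Hypothesis dist0 : forall x y, dist x y = 0 <-> x = y.
Hypothesis dist_sym : forall x y, dist x y = dist y x.
Hypothesis dist_tri : forall x y z, dist x z <= dist x y + dist y z.
Hypothesis dist_nbhs : forall y (A : set Y),
  nbhs y A <-> exists2 e : R, 0 < e & [set z | dist y z < e] `<=` A.
Hypothesis open_pre : forall A : set Y, open A -> measurable (pi @^-1` A).

(** Inner regularity of the image measure, expressed through preimages so that only [mu] is handled.
    Measurability of the preimage is carried along in the same induction over the Borel
    sigma-algebra. *)
Definition closed_approx (A : set Y) : Prop :=
  measurable (pi @^-1` A) /\ forall e : R, 0 < e ->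
    exists K, [/\ closed K, K `<=` A & prob mu (pi @^-1` (A `\` K)) <= e].

Lemma closed_pre (A : set Y) : closed A -> measurable (pi @^-1` A).
Proof.
move=> cA; rewrite -[A]setCK preimage_setC; apply: measurableC.
exact: (open_pre (closed_openC cA)).
Qed.

Lemma closed_approx_closed (F : set Y) : closed F -> closed_approx F.
Proof.
move=> cF; split; first exact: closed_pre.
move=> e e0; exists F; split=> //.
by rewrite setDv preimage_set0 /prob measure0 ltW.
Qed.

(** The points at distance at least 1/(n+1) from [F] form closed sets that increase to the
    complement of [F]. *)
Lemma closed_approx_open (F : set Y) : closed F -> closed_approx (~` F).
Proof.
move=> cF; have oF : open (~` F) by exact: closed_openC.
split=> [|e e0]; first exact: (open_pre oF).
pose C (n : nat) : set Y := [set y | forall z, F z -> n.+1%:R^-1 <= dist y z].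
have cC n : closed (C n).
  rewrite -[C n]setCK; apply: open_closedC; rewrite openE => y Cy.
  have [z [Fz yz]] : exists z, F z /\ dist y z < n.+1%:R^-1.
    apply: contrapT => H; apply: Cy => z Fz; rewrite leNgt; apply/negP => h.
    by apply: H; exists z.
  apply/dist_nbhs; exists (n.+1%:R^-1 - dist y z); first by rewrite subr_gt0.
  move=> y' /= yy' /(_ z Fz); rewrite leNgt => /negP; apply.
  have := dist_tri y' y z; rewrite (dist_sym y' y).
  by move: (_^-1) yy' => t; lra.
have [n hn] : exists n, prob mu (pi @^-1` (~` F `\` C n)) <= e.
  apply: prob_vanish => //.
  - by move=> n; apply: measurableD; [exact: (open_pre oF)|exact: (closed_pre (cC n))].
  - move=> n x [Fx Cx]; split=> // Cn; apply: Cx => z /Cn; apply: le_trans.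
    by rewrite lef_pV2 ?posrE // ler_nat.
  - apply/seteqP; split=> // x H; have [Fx _] := H 0%N I.
    have : nbhs (pi x) (~` F) by exact: open_nbhs_nbhs.
    move=> /dist_nbhs[r r0 rF].
    have [n nr] : exists n, n.+1%:R^-1 < r.
      exists (Num.truncn r^-1); rewrite invf_plt ?posrE //.
      exact: truncnS_gt.
    have [_] := H n I; apply=> z Fz; apply: (le_trans (ltW nr)).
    by rewrite leNgt; apply/negP => h; exact: (rF z h).
exists (C n); split=> // y Cy Fy.
have := Cy y Fy; have /dist0 -> : y = y by []; rewrite leNgt => /negP; apply.
by rewrite invr_gt0.
Qed.

Lemma closed_approx_bigcup (A : nat -> set Y) :
  (forall n, closed_approx (A n)) -> closed_approx (\bigcup_n A n).
Proof.
move=> rA; have mA : measurable (pi @^-1` \bigcup_n A n).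
  by rewrite preimage_bigcup; apply: bigcup_measurable => n _; exact: (rA n).1.
split=> // e e0; have e2 : 0 < e / 2 by rewrite divr_gt0.
pose B N : set Y := \bigcup_(n in [set n | (n < N)%N]) A n.
have mB N : measurable (pi @^-1` B N).
  by rewrite preimage_bigcup; apply: bigcup_measurable => n _; exact: (rA n).1.
have [N hN] : exists N, prob mu (pi @^-1` (\bigcup_n A n `\` B N)) <= e / 2.
  apply: prob_vanish => //.
  - by move=> n; exact: (measurableD mA (mB n)).
  - move=> n x [Ax Bx]; split=> // -[k kn Ak]; apply: Bx.
    by exists k => //; exact: ltnW.
  - apply/seteqP; split=> // x H; have [[n _ An] _] := H 0%N I.
    by have [_] := H n.+1 I; apply; exists n => //=.
have eN : 0 < e / 2 / N.+1%:R by rewrite divr_gt0.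
have /choice[K KP] n := (rA n).2 _ eN.
exists (\bigcup_(n in [set n | (n < N)%N]) K n); split.
- apply: closed_bigcup => [|n _]; first exact: finite_II.
  by have [] := KP n.
- by move=> y [n nN Kn]; exists n => //; have [_ + _] := KP n; apply.
have mD n : measurable (pi @^-1` (A n `\` K n)).
  apply: (measurableD (rA n).1).
  by apply: closed_pre; have [] := KP n.
have mU : measurable (\bigcup_(i : 'I_N) (pi @^-1` (A i `\` K i))).
  exact: fin_bigcup_measurable.
have sub : pi @^-1` (\bigcup_n A n `\` \bigcup_(n in [set n | (n < N)%N]) K n) `<=`
    pi @^-1` (\bigcup_n A n `\` B N) `|` \bigcup_(i : 'I_N) (pi @^-1` (A i `\` K i)).
  move=> x [Ax Kx]; have [[n nN An]|nB] := pselect (B N (pi x)).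
    right; exists (Ordinal nN) => //; split=> //= Kn; apply: Kx.
    by exists n.
  by left.
apply: (@le_trans _ _ (prob mu (pi @^-1` (\bigcup_n A n `\` B N) `|`
    \bigcup_(i : 'I_N) (pi @^-1` (A i `\` K i))))).
  apply: prob_le sub; last by exact: (measurableU _ _ (measurableD mA (mB N)) mU).
  apply: (measurableD mA); apply: closed_pre; apply: closed_bigcup => [|n _].
    exact: finite_II.
  by have [] := KP n.
apply: (le_trans (probU_le _ (measurableD mA (mB N)) mU)).
have := @prob_bigcup_le _ _ _ mu 'I_N (fun i => pi @^-1` (A i `\` K i))
  (fun=> e / 2 / N.+1%:R) (fun i => mD i).
rewrite sumr_const card_ord => /(_ _)/le_trans H.
rewrite [leRHS](splitr e); apply: lerD => //; apply: H => [i|].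
  by have [] := KP i.
rewrite -[leLHS]mulr_natr -[leLHS]mulrA ger_pMr // mulrC ler_pdivrMr // mul1r.
rewrite ler_nat.
exact: leqnSn.
Qed.

Lemma closed_approx_bigcap (A : nat -> set Y) :
  (forall n, closed_approx (A n)) -> closed_approx (\bigcap_n A n).
Proof.
move=> rA; have mA : measurable (pi @^-1` \bigcap_n A n).
  by rewrite preimage_bigcap; apply: bigcap_measurable => // n _; exact: (rA n).1.
split=> // e e0; have e2 : 0 < e / 2 by rewrite divr_gt0.
(* The errors of any finitely many sets add up to at most e / 2; the other half pays for the passage
   from finitely many sets to all of them. *)
have en n : 0 < e / 2 / (2 ^ n.+1)%:R.
  by rewrite divr_gt0 // ltr0n expn_gt0.
have /choice[K KP] n := (rA n).2 _ (en n).
have cK : closed (\bigcap_n K n) by apply: closed_bigI => n _; have [] := KP n.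
exists (\bigcap_n K n); split=> //.
  by move=> y Ky n _; have [_ + _] := KP n; apply; exact: Ky.
have mD n : measurable (pi @^-1` (A n `\` K n)).
  apply: (measurableD (rA n).1).
  by apply: closed_pre; have [] := KP n.
pose B N : set X := \bigcup_(i : 'I_N) (pi @^-1` (A i `\` K i)).
have mB N : measurable (B N) by exact: fin_bigcup_measurable.
set S := pi @^-1` _; have mS : measurable S.
  exact: (measurableD mA (closed_pre cK)).
have [N hN] : exists N, prob mu (S `\` B N) <= e / 2.
  apply: prob_vanish => //.
  - by move=> n; exact: measurableD.
  - move=> n x [Sx Bx]; split=> // -[i _ ABi]; apply: Bx.
    by exists (widen_ord (leqnSn n) i).
  - apply/seteqP; split=> // x H; have [[Ax Kx] _] := H 0%N I.
    apply: Kx => n _; apply: contrapT => Kn.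
    have [_] := H n.+1 I; apply; exists ord_max => //; split=> //.
    exact: Ax.
have BN : prob mu (B N) <= e / 2.
  have := @prob_bigcup_le _ _ _ mu 'I_N (fun i => pi @^-1` (A i `\` K i))
    (fun i => e / 2 / (2 ^ i.+1)%:R) (fun i => mD i).
  move=> /(_ _)/le_trans; apply=> [i|]; first by have [] := KP i.
  rewrite -mulr_sumr ger_pMr //.
  suff -> : \sum_(i < N) (2 ^ i.+1)%:R^-1 = 1 - (2 ^ N)%:R^-1 :> R.
    by rewrite gerBl invr_ge0.
  elim: N {hN} => [|N IH]; first by rewrite big_ord0 expn0 invr1 subrr.
  rewrite big_ord_recr /= IH expnS natrM.
  have : (2 ^ N)%:R != 0 :> R by rewrite pnatr_eq0 -lt0n expn_gt0.
  by move=> h; field.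
have -> : S = (S `\` B N) `|` (S `&` B N) by rewrite setUC setUIDK.
rewrite [leRHS](splitr e); apply: (le_trans (probU_le _ _ _)).
- exact: measurableD.
- exact: measurableI.
apply: lerD => //; apply: le_trans BN; apply: prob_le => //.
exact: measurableI.
Qed.

(** Stability under complements is built in by asking for the approximation of a set and of its
    complement; the sets obtained form a sigma-algebra containing the open sets. *)
Lemma borel_closed_approx (A : set Y) : <<s open >> A -> closed_approx A.
Proof.
pose G B := closed_approx B /\ closed_approx (~` B).
have sG : sigma_algebra setT G.
  split.
  - split; first exact: closed_approx_closed closed0.
    by rewrite setC0; apply: closed_approx_closed; exact: closedT.
  - by move=> B [rB rC]; rewrite setTD /G setCK.
  - move=> F rF; split; first by apply: closed_approx_bigcup => n; exact: (rF n).1.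
    by rewrite setC_bigcup; apply: closed_approx_bigcap => n; exact: (rF n).2.
have oG : open `<=` G.
  move=> B oB; split; last by apply: closed_approx_closed; exact: open_closedC.
  by rewrite -[B]setCK; apply: closed_approx_open; exact: open_closedC.
by move=> bA; have [] := smallest_sub sG oG bA.
Qed.

(** Each [y] gets a radius [r y] at most its distance to every [K i] that misses it. If half balls
    around y in K i and y' in K j met, the distance from y to y' would be less than the mean of the
    two radii, yet it is at least each of them. *)
Lemma closed_disjoint_open (I : finType) (K : I -> set Y) :
  (forall i, closed (K i)) -> (forall i j, i != j -> K i `&` K j = set0) ->
  exists U : I -> set Y, [/\ forall i, open (U i), forall i, K i `<=` U i &
    forall i j, i != j -> U i `&` U j = set0].
Proof.
move=> cK dK.
have /choice[r rP] : forall y, exists r : R, 0 < r /\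
    forall i, ~ K i y -> forall z, K i z -> r <= dist y z.
  move=> y; have /choice[r rP] : forall i, exists r : R, 0 < r /\
      (~ K i y -> forall z, K i z -> r <= dist y z).
    move=> i; have [Ky|nKy] := pselect (K i y); first by exists 1.
    have : nbhs y (~` K i).
      by apply: open_nbhs_nbhs; split=> //; exact: closed_openC.
    move=> /dist_nbhs[e e0 eK]; exists e; split=> // _ z Kz.
    by rewrite leNgt; apply/negP => h; exact: (eK z h).
  exists (\big[Order.min/1]_i r i); split.
    by elim/big_ind : _ => // [a b a0 b0|i _]; [rewrite lt_min a0|exact: (rP i).1].
  move=> i nKi z Kz; apply: le_trans ((rP i).2 nKi z Kz).
  exact: bigmin_le_cond.
pose U i : set Y := [set z | exists y, K i y /\ dist y z < r y / 2].
exists U; split.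
- move=> i; rewrite openE => z [y [Ky yz]]; apply/dist_nbhs.
  exists (r y / 2 - dist y z); first by rewrite subr_gt0.
  move=> z' /= zz'; exists y; split=> //.
  by have := dist_tri y z z'; lra.
- move=> i y Ky; exists y; split=> //; have /dist0 -> : y = y by [].
  by rewrite divr_gt0 // (rP y).1.
- move=> i j ij; apply/seteqP; split=> // z [[y [Ky yz]] [y' [Ky' yz']]].
  have Kiy' : ~ K i y' by move=> h; have : (K i `&` K j) y' by []; rewrite dK.
  have Kjy : ~ K j y by move=> h; have : (K i `&` K j) y by []; rewrite dK.
  have := (rP y).2 j Kjy y' Ky'; have := (rP y').2 i Kiy' y Ky.
  by have := dist_tri y z y'; rewrite (dist_sym z y') (dist_sym y' y); lra.
Qed.

End closed_approximation.

(** * Counting names *)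

(* Gibbs' inequality against the weights [1/(2#|W|)] on [W] and [1/(2#|T|)]
   elsewhere. *)
Lemma entropy_le_card (R : realType) (T : finType) (W : {set T}) (q : T -> R)
    (b : R) : (0 < #|W|)%N -> (forall t, 0 <= q t) -> \sum_t q t = 1 ->
  \sum_(t | t \notin W) q t <= b ->
  - \sum_t q t * ln (q t) <= ln 2 + ln #|W|%:R + b * ln #|T|%:R.
Proof.
move=> W0 q0 q1 qb.
have T0 : (0 < #|T|)%N by apply: leq_trans W0 (max_card _).
pose w t : R := if t \in W then (2 * #|W|%:R)^-1 else (2 * #|T|%:R)^-1.
have gibbs t : - (q t * ln (q t)) <= q t * - ln (w t) + (w t - q t).
  have w0 : 0 < w t.
    by rewrite /w; case: ifP => _; rewrite invr_gt0 mulr_gt0 ?ltr0n.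
  have [->|qt] := eqVneq (q t) 0; first by rewrite !mul0r oppr0 add0r addr0 ltW.
  have qp : 0 < q t by rewrite lt_neqAle eq_sym qt q0.
  have := le_ln1Dx (x := w t / q t - 1); rewrite ltrBrDl subrr divr_gt0 //.
  move=> /(_ isT); rewrite addrCA subrr addr0 ln_div ?posrE // => h.
  have := ler_wpM2l (ltW qp) h; rewrite mulrBr mulrBr mulrCA divff // !mulr1.
  by lra.
rewrite -sumrN; apply: (le_trans (ler_sum _ (fun t _ => gibbs t))).
rewrite big_split /= sumrB q1.
have sw : \sum_t w t <= 1.
  rewrite (bigID (mem W)) /= (eq_bigr (fun=> (2 * #|W|%:R)^-1)); last first.
    by move=> t tW; rewrite /w tW.
  rewrite sumr_const [X in _ + X](eq_bigr (fun=> (2 * #|T|%:R)^-1)); last first.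
    by move=> t tW; rewrite /w (negPf tW).
  rewrite sumr_const -[X in X + _]mulr_natr -[X in _ + X]mulr_natr !invfM.
  rewrite -!mulrA mulVf ?pnatr_eq0 -?lt0n // mulr1.
  have : #|T|%:R^-1 * #|[predC W]|%:R <= 1 :> R.
    by rewrite mulrC ler_pdivrMr ?ltr0n // mul1r ler_nat max_card.
  by move=> h; have := @splitr R 1; rewrite mul1r; lra.
have lnT : 0 <= ln (#|T|%:R : R) by rewrite ln_ge0 // ler1n.
have lnW : 0 <= ln (#|W|%:R : R) by rewrite ln_ge0 // ler1n.
have sq : \sum_t q t * - ln (w t) <= \sum_t q t * (ln 2 + ln #|W|%:R)
    + (\sum_(t | t \notin W) q t) * ln #|T|%:R.
  rewrite mulr_suml [X in _ <= _ + X]big_mkcond -big_split /=; apply: ler_sum => t _.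
  rewrite /w; case: (boolP (t \in W)) => tW /=.
    by rewrite lnV ?posrE ?mulr_gt0 ?ltr0n // opprK lnM ?posrE ?ltr0n // addr0.
  rewrite lnV ?posrE ?mulr_gt0 ?ltr0n // opprK lnM ?posrE ?ltr0n //.
  by have := mulr_ge0 (q0 t) lnW; lra.
have := ler_wpM2r lnT qb; rewrite -mulr_suml q1 in sq *.
by lra.
Qed.

(** * Hamming balls and separated sets of words *)

Section hamming.
Variables (n k : nat).
Notation word := {ffun 'I_n -> 'I_k}.

Definition hamming (w w' : word) : nat := #|[set j | w j != w' j]%SET|.

(** Chernoff's bound: the sum of exp(- tau * distance) over all words factors over the coordinates,
    and each word of the ball contributes at least exp(- tau * rho). *)
Lemma hamming_ball_card (R : realType) (w : word) (tau rho : R) : 0 <= tau ->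
  #|[set w' | (hamming w w')%:R <= rho]%SET|%:R <=
    expR (tau * rho) * (1 + k%:R * expR (- tau)) ^+ n.
Proof.
move=> tau0; set t := expR (- tau).
have total : \sum_(w' : word) t ^+ hamming w w' <= (1 + k%:R * t) ^+ n.
  have -> : \sum_(w' : word) t ^+ hamming w w' =
      \sum_(w' : word) \prod_j (if w j == w' j then 1 else t).
    apply: eq_bigr => w' _; rewrite /hamming -prodr_const big_mkcond.
    by apply: eq_bigr => j _; rewrite inE; case: eqP.
  rewrite -(bigA_distr_bigA (fun j a => if w j == a then 1 else t)).
  rewrite -[n in leRHS]card_ord -prodr_const; apply: ler_prod => j _.
  apply/andP; split.
    by apply: sumr_ge0 => a _; case: ifP => _ //; exact: expR_ge0.
  rewrite (bigD1 (w j)) //= eqxx lerD2l.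
  rewrite (eq_bigr (fun=> t)) => [|a]; last by rewrite eq_sym => /negPf ->.
  rewrite sumr_const -[leLHS]mulr_natl ler_wpM2r ?expR_ge0 // ler_nat.
  by rewrite -[leqRHS]card_ord max_card.
rewrite -ler_pdivrMl ?expR_gt0 // -expRN; apply: le_trans total.
rewrite mulr_natr -sumr_const.
apply: (@le_trans _ _ (\sum_(w' in [set w' | (hamming w w')%:R <= rho]%SET)
    t ^+ hamming w w')).
  apply: ler_sum => w'; rewrite inE => hw.
  rewrite -expRM_natl ler_expR mulrN lerN2 mulrC.
  exact: ler_wpM2l.
rewrite [leRHS](bigID (mem [set w' | (hamming w w')%:R <= rho]%SET)) /= lerDl.
by apply: sumr_ge0 => w' _; rewrite exprn_ge0 // expR_ge0.
Qed.

(** The balls around a maximal separated subset cover [S], since an uncovered word could be added to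
    it. *)
Lemma hamming_separated (R : realType) (S : {set word}) (tau rho : R) :
  0 <= tau -> 0 <= rho ->
  exists S' : {set word}, [/\ S' \subset S,
    forall w w', w \in S' -> w' \in S' -> w != w' -> rho < (hamming w w')%:R &
    #|S|%:R <= #|S'|%:R * (expR (tau * rho) * (1 + k%:R * expR (- tau)) ^+ n)].
Proof.
move=> tau0 rho0.
pose sep (A : {set word}) := (A \subset S) &&
  [forall w in A, forall w' in A, (w != w') ==> (rho < (hamming w w')%:R)].
have sep0 : sep finset.set0.
  by rewrite /sep finset.sub0set; apply/forall_inP => w; rewrite inE.
have [S' /maxsetP[/andP[S'S sepS'] maxS'] _] := maxset_exists sep0.
have sepP w w' : w \in S' -> w' \in S' -> w != w' -> rho < (hamming w w')%:R.
  by move=> wS w'S; move/forall_inP: sepS' => /(_ w wS)/forall_inP/(_ w' w'S)/implyP.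
exists S'; split=> //.
have cov : S \subset (\bigcup_(w in S') [set w' | ((hamming w w')%:R <= rho)%R])%SET.
  apply/fintype.subsetP => w wS; apply: contraT => /bigcupP nw.
  have far w' : w' \in S' -> rho < (hamming w' w)%:R.
    by move=> w'S; rewrite ltNge; apply/negP => h; apply: nw; exists w'; rewrite ?inE.
  have symH a b : hamming a b = hamming b a.
    by apply: eq_card => j; rewrite !inE eq_sym.
  have : (w |: S')%SET = S'.
    apply: maxS'; last exact: finset.subsetUr.
    rewrite /sep finset.subUset finset.sub1set wS S'S /=.
    apply/forall_inP => a; rewrite !inE => aS; apply/forall_inP => b.
    rewrite !inE => bS; apply/implyP => ab.
    case/orP: aS => [/eqP ea|aS]; case/orP: bS => [/eqP eb|bS].
    - by rewrite ea eb eqxx in ab.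
    - by rewrite ea symH far.
    - by rewrite eb far.
    - exact: sepP.
  move=> wS'; exfalso; apply: nw; exists w; first by rewrite -wS' !inE eqxx.
  rewrite inE (_ : hamming w w = 0%N) //; apply/eqP; rewrite cards_eq0.
  by apply/eqP/finset.setP => j; rewrite !inE eqxx.
have cS : (#|S| <= \sum_(w in S') #|[set w' | ((hamming w w')%:R <= rho)%R]%SET|)%N.
  apply: (leq_trans (subset_leq_card cov)).
  elim/big_rec2 : _ => [|w m A _ h]; first by rewrite cards0.
  by apply: (leq_trans (leq_card_setU _ _)); rewrite leq_add2l.
move: cS; rewrite -(ler_nat R) natr_sum => /le_trans; apply.
rewrite mulr_natl -sumr_const; apply: ler_sum => w _.
exact: hamming_ball_card.
Qed.

End hamming.

Definition visits (X : Type) (f : X -> X) (D : set X) (n : nat) (x : X) :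
    {set 'I_n} :=
  [set j : 'I_n | `[< D (iter j f x) >]]%SET.

Section visits.
Variables (R : realType) (d : measure_display) (X : measurableType d).
Variables (mu : probability X R) (f : X -> X).
Hypothesis mf : forall A, measurable A -> measurable (f @^-1` A).
Hypothesis inv : invariant_measure f mu.

Lemma iter_measurable n A : measurable A -> measurable (iter n f @^-1` A).
Proof.
move=> mA; elim: n => // n IH.
have -> : iter n.+1 f @^-1` A = f @^-1` (iter n f @^-1` A).
  by apply/seteqP; split=> x /=; rewrite -iterSr.
exact: mf.
Qed.

Lemma prob_iter n A : measurable A -> prob mu (iter n f @^-1` A) = prob mu A.
Proof.
move=> mA; elim: n => // n IH.
have -> : iter n.+1 f @^-1` A = f @^-1` (iter n f @^-1` A).
  by apply/seteqP; split=> x /=; rewrite -iterSr.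
by rewrite -IH /prob inv //; exact: iter_measurable.
Qed.

Lemma visits_measurable D n (S : {set 'I_n}) : measurable D ->
  measurable [set x | visits f D n x = S].
Proof.
move=> mD.
have -> : [set x | visits f D n x = S] = \bigcap_(j : 'I_n)
    (if j \in S then iter j f @^-1` D else ~` (iter j f @^-1` D)).
  apply/seteqP; split=> [x /= <- j _|x H].
    by rewrite inE; case: asboolP.
  apply/finset.setP => j; rewrite inE; have := H j I.
  by case: (j \in S) => /= Dj; apply/asboolP.
apply: fin_bigcap_measurable => // j _.
by case: ifP => _; [|apply: measurableC]; exact: iter_measurable.
Qed.

(* Markov's inequality: the expected number of visits is [n * prob mu D]. *)
Lemma frequent_visits D n (c : R) : measurable D -> 0 < c ->
  measurable [set x | c * n%:R < #|visits f D n x|%:R] /\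
  prob mu [set x | c * n%:R < #|visits f D n x|%:R] <= prob mu D / c.
Proof.
move=> mD c0.
have mv S : measurable [set x | visits f D n x = S] by exact: visits_measurable.
have [mQ ->] := prob_fibers mu (g := visits f D n)
  (fun S : {set 'I_n} => c * n%:R < #|S|%:R) mv.
split=> //.
have [n0|n0] := posnP n.
  rewrite big1 => [|S]; first by rewrite divr_ge0 ?prob_ge0 // ltW.
  have S0 : #|S| = 0%N by apply/eqP; rewrite -leqn0 -n0 -[leqRHS]card_ord max_card.
  by rewrite S0 ltNge mulr_ge0 // ltW.
rewrite ler_pdivlMr //.
have nR : 0 < n%:R :> R by rewrite ltr0n.
rewrite -(ler_pM2r nR) -mulrA.
have -> : prob mu D * n%:R =
    \sum_(S : {set 'I_n}) #|S|%:R * prob mu [set x | visits f D n x = S].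
  have -> : prob mu D * n%:R = \sum_(j < n) prob mu (iter j f @^-1` D).
    rewrite (eq_bigr (fun=> prob mu D)) => [|j _]; last exact: prob_iter.
    by rewrite sumr_const card_ord mulr_natr.
  rewrite (eq_bigr (fun j : 'I_n => \sum_(S : {set 'I_n} | j \in S)
    prob mu [set x | visits f D n x = S])) => [|j _]; last first.
    have [_ <-] := prob_fibers mu (g := visits f D n) (fun S : {set 'I_n} => j \in S) mv.
    by congr prob; apply/seteqP; split=> x /=; rewrite inE => /asboolP.
  rewrite (exchange_big_dep xpredT) //=; apply: eq_bigr => S _.
  by rewrite sumr_const mulr_natl.
rewrite mulr_suml [leRHS](bigID (fun S : {set 'I_n} => c * n%:R < #|S|%:R)) /=.
rewrite -[leLHS]addr0 lerD //.
  by apply: ler_sum => S hS; rewrite mulrC ler_wpM2r ?prob_ge0 // ltW.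
by apply: sumr_ge0 => S _; rewrite mulr_ge0 // prob_ge0.
Qed.

End visits.

(** * Finite windows that determine the label of the image *)

Section good_cells.
Variables (R : realType) (X Y : topologicalType).
Variables (f : X -> X) (pi : X -> Y).
Variables (V : countType) (E : rel V) (phi : X -> markov_shift E).
Hypotheses (phi_homeo : homeomorphism phi)
  (phi_f : forall x, phi (f x) = markov_map E (phi x)).
Hypotheses (cpi : continuous pi).
Notation code := (code phi).

Lemma code_continuous : continuous f.
Proof.
move=> x B /(code_nbhsP phi_homeo)[m mB]; apply/(code_nbhsP phi_homeo).
exists m.+1 => y yx; apply: mB => n nm.
have c1 z : code (f z) = shift_by 1 (code z) := code_iter phi_f 1 z.
by rewrite !c1 /shift_by; apply: yx; lia.
Qed.

Lemma code_open n (S : set V) : open [set x | S (code x n)].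
Proof.
rewrite openE => x Sx; apply/(code_nbhsP phi_homeo); exists (absz n) => y yx.
by rewrite /= yx //; lia.
Qed.

Lemma continuous_borel (A B : topologicalType) (a : A) (b : B) (g : A -> B) :
  continuous g -> forall S : set (borel b), measurable S ->
  @measurable _ (borel a) (g @^-1` S).
Proof.
move=> /continuousP cg S mS.
pose G : set (set B) := [set S | @measurable _ (borel a) (g @^-1` S)].
have sG : sigma_algebra setT G.
  split; rewrite /G /=.
  - exact: measurable0.
  - move=> C mC; rewrite setTD preimage_setC; exact: measurableC.
  - move=> F mF; rewrite preimage_bigcup; exact: bigcup_measurable.
by apply: (smallest_sub sG _ mS) => C oC; apply: sub_sigma_algebra; exact: cg.
Qed.

Lemma borel_open (A : topologicalType) (a : A) (S : set A) :
  open S -> @measurable _ (borel a) S.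
Proof. exact: sub_sigma_algebra. Qed.

Variables (x0 : X) (mu : probability (borel x0) R).

(** The cells of [P] may touch, so no window need reveal the cell near their boundaries. Shrinking
    them to disjoint closed sets [K i] leaves room for disjoint open sets [U i] around these. *)
Lemma good_cells (k : nat) (P : 'I_k -> set (borel (pi x0))) (e : R) :
  polish R Y -> finite_partition P -> 0 < e ->
  exists (m : nat) (good : 'I_k -> set X), [/\ forall i, open (good i),
    forall i x y, agree m (code y) (code x) -> good i x -> good i y,
    forall i j x y, i != j -> good i x -> good j y -> pi x <> pi y &
    prob mu (~` \bigcup_i (pi @^-1` P i `&` good i)) <= e].
Proof.
move=> [_ [dist [[_ d0 dsym dtri] [dnbhs _]]]] [mP tP cP] e0.
have mpi (S : set Y) : @measurable _ (borel (pi x0)) S ->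
  @measurable _ (borel x0) (pi @^-1` S) by exact: continuous_borel.
have opi (S : set Y) : open S -> @measurable _ (borel x0) (pi @^-1` S).
  by move=> oS; apply: mpi; exact: borel_open.
(* Each of the [k] cells loses mass twice, from [P i] to [K i] and from [K i] to the good points;
   k.+1 avoids a division by 0. *)
have ek : 0 < e / 2 / k.+1%:R by rewrite !divr_gt0.
have /choice[K KP] i :=
  (borel_closed_approx mu (pi := pi) d0 dsym dtri dnbhs opi (mP i)).2 _ ek.
have cK i : closed (K i) by have [] := KP i.
have KsubP i : K i `<=` P i by have [] := KP i.
have dK i j : i != j -> K i `&` K j = set0.
  move=> ij; apply/seteqP; split=> // y [/KsubP Pi /KsubP Pj].
  move: ij; rewrite (tP i j) ?eqxx //.
  by exists y.
have [U [oU KU dU]] := closed_disjoint_open d0 dsym dtri dnbhs cK dK.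
(* Asking the whole cylinder of window [m] to be sent into [U i] makes membership depend on the
   window only; by continuity of [pi] these sets exhaust the preimage of [K i] as [m] grows. *)
pose good m i : set X := [set x | forall y, agree m (code y) (code x) -> U i (pi y)].
have agree_trans m (a b c : int -> V) : agree m a b -> agree m b c -> agree m a c.
  by move=> ab bc n nm; rewrite ab // bc.
have good_agree m i x y : agree m (code y) (code x) -> good m i x -> good m i y.
  by move=> yx gx z zy; apply: gx; exact: agree_trans yx.
have good_mono m m' i : (m <= m')%N -> good m i `<=` good m' i.
  move=> mm' x gx y yx; apply: gx => n nm; apply: yx; lia.
have good_open m i : open (good m i).
  rewrite openE => x gx; apply/(code_nbhsP phi_homeo); exists m => y yx.
  exact: good_agree gx.
have goodU m i x : good m i x -> U i (pi x) by apply.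
have mK i : @measurable _ (borel x0) (pi @^-1` K i).
  apply: mpi; rewrite -[K i]setCK; apply: measurableC.
  by apply: borel_open; exact: closed_openC.
have mgood m i : @measurable _ (borel x0) (good m i) by exact: borel_open.
have /choice[mi miP] : forall i, exists m,
    prob mu (pi @^-1` K i `\` good m i) <= e / 2 / k.+1%:R.
  move=> i; apply: prob_vanish => //.
  - by move=> n; exact: (measurableD (mK i) (mgood n i)).
  - by move=> n x [Kx gx]; split=> // /(good_mono _ _ _ (leqnSn n)).
  - apply/seteqP; split=> // x H; have [Kx _] := H 0%N I.
    have : nbhs x (pi @^-1` U i).
      by apply: cpi; apply: open_nbhs_nbhs; split; [exact: oU|exact: KU].
    move=> /(code_nbhsP phi_homeo)[m mU]; have [_] := H m I; apply.
    exact: mU.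
pose m := (\max_i mi i)%N.
exists m, (good m); split=> //; first exact: good_agree.
  move=> i j x y ij /goodU Ux /goodU Uy xy.
  have UU : (U i `&` U j) (pi x) by split=> //; rewrite xy.
  by rewrite dU in UU.
pose F i : set X := pi @^-1` (P i `\` K i) `|` (pi @^-1` K i `\` good (mi i) i).
have mF i : @measurable _ (borel x0) (F i).
  apply: measurableU; last exact: (measurableD (mK i) (mgood _ i)).
  exact: (measurableD (mpi _ (mP i)) (mK i)).
have mB : @measurable _ (borel x0) (~` \bigcup_i (pi @^-1` P i `&` good m i)).
  apply: measurableC; apply: fin_bigcup_measurable => // i _.
  exact: (measurableI _ _ (mpi _ (mP i)) (mgood m i)).
have sub : (~` \bigcup_i (pi @^-1` P i `&` good m i)) `<=` \bigcup_i F i.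
  move=> x nx; have : [set: Y] (pi x) by [].
  rewrite -[[set: Y]]/[set: borel (pi x0)] -cP => -[i _ Pix]; exists i => //.
  have [Kx|nKx] := pselect (K i (pi x)); last by left.
  right; split=> // gx; apply: nx; exists i => //; split=> //.
  by apply: good_mono gx; exact: leq_bigmax.
apply: (le_trans (prob_le mu mB (fin_bigcup_measurable _ (fun i _ => mF i)) sub)) => //.
have := @prob_bigcup_le _ _ _ mu 'I_k F (fun=> e / 2 / k.+1%:R + e / 2 / k.+1%:R) mF.
move=> /(_ _)/le_trans; apply=> [i|].
  apply: (le_trans (probU_le mu (measurableD (mpi _ (mP i)) (mK i))
    (measurableD (mK i) (mgood _ i)))).
  by apply: lerD => //; have [] := KP i.
rewrite sumr_const card_ord -mulrDl -splitr -[leLHS]mulr_natr -mulrA ger_pMr //.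
by rewrite mulrC ler_pdivrMr // mul1r ler_nat.
Qed.

(** Tightness of the law of one coordinate, a substitute for a finite alphabet. *)
Lemma finitely_many_letters (n : int) (e : R) : 0 < e ->
  exists N : nat, prob mu [set x | ~ (pickle (code x n) < N)%N] <= e.
Proof.
move=> e0; apply: prob_vanish => //.
- by move=> N; apply: borel_open; exact: (@code_open n [set v | ~ (pickle v < N)%N]).
- by move=> N x /= h1 h2; apply: h1; exact: ltnW.
- by apply/seteqP; split=> // x H; have := H (pickle (code x n)).+1 I; apply.
Qed.

End good_cells.

(* The junk value [0] of [limn] at a divergent sequence is excluded by [0 <= h]. *)
Lemma lim_gt_eventually (R : realType) (u : nat -> R) (h : R) : 0 <= h ->
  h < limn u -> exists2 eta, 0 < eta & \forall n \near \oo, h + eta <= u n.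
Proof.
move=> h0 hu; have [cu|ncu] := pselect (cvgn u); last first.
  by move: hu; rewrite (dvgP ncu) ltNge h0.
exists ((limn u - h) / 2); first by rewrite divr_gt0 // subr_gt0.
have /cvgrPdist_lt/(_ ((limn u - h) / 2)) := cu.
rewrite divr_gt0 ?subr_gt0 // => /(_ isT).
apply: filterS => n; rewrite ltr_norml => /andP[_]; lra.
Qed.

(** * Exponentially many names with controlled representatives *)

Section names.
Variables (R : realType) (X Y : topologicalType).
Variables (f : X -> X) (T : Y -> Y) (pi : X -> Y).
Variables (V : countType) (E : rel V) (phi : X -> markov_shift E).
Hypotheses (phi_homeo : homeomorphism phi)
  (phi_f : forall x, phi (f x) = markov_map E (phi x)).
Hypotheses (cpi : continuous pi) (pi_f : forall x, pi (f x) = T (pi x)).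
Hypothesis polY : polish R Y.
Notation code := (code phi).
Variables (x0 : X) (mu : probability (borel x0) R).
Hypothesis inv : invariant_measure (f : borel x0 -> borel x0) mu.
Variables (k : nat) (P : 'I_k -> set (borel (pi x0))) (h : R).
Hypotheses (partP : finite_partition P) (h_ge0 : 0 <= h).
Hypothesis h_lt : h < partition_entropy (T : borel (pi x0) -> borel (pi x0))
  (pushforward mu (pi : borel x0 -> borel (pi x0))) P.

(** The margin [eta] depends on the entropy alone and precedes [e], which can therefore be taken
    small against it. The names in [W] are those of points outside three exceptional events of
    measure at most [e] each, so the remaining names enter the entropy bound with total mass at most
    3 * e. *)
Lemma many_names : exists2 eta : R, 0 < eta & forall e : R, 0 < e -> 3 * e < 1 ->
  exists (m N : nat) (good : 'I_k -> set X),
  [/\ forall i x y, agree m (code y) (code x) -> good i x -> good i y,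
      forall i j x y, i != j -> good i x -> good j y -> pi x <> pi y &
      \forall n \near \oo, exists (W : {set {ffun 'I_n -> 'I_k}})
        (pt : {ffun 'I_n -> 'I_k} -> X),
        [/\ (0 < #|W|)%N,
            n%:R * (h + eta) <= ln 2 + ln #|W|%:R + 3 * e * (n%:R * ln k%:R) &
            forall w, w \in W ->
              [/\ (pickle (code (pt w) (- m%:Z)) < N)%N,
                  (pickle (code (pt w) (n + m)%N%:Z) < N)%N &
                  exists2 bad : {set 'I_n}, #|bad|%:R <= e * n%:R &
                    forall j, j \notin bad -> good (w j) (iter j f (pt w))]]].
Proof.
have [eta eta0 ent] := lim_gt_eventually h_ge0 h_lt.
exists eta => // e e0 e1.
(* The exceptional set gets measure at most e * e, so that by Markov's inequality it is visited more
   than e * n times with probability at most [e]. *)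
have [m [good [ogood agood dgood Dgood]]] :=
  good_cells phi_homeo cpi mu polY partP (mulr_gt0 e0 e0).
have [N hN] := finitely_many_letters phi_homeo mu (- m%:Z) e0.
exists m, N, good; split=> //.
have mf (A : set X) : @measurable _ (borel x0) A -> @measurable _ (borel x0) (f @^-1` A).
  by apply: (@continuous_borel X X x0 x0 f); exact: code_continuous phi_f.
have mpi (S : set Y) : @measurable _ (borel (pi x0)) S ->
    @measurable _ (borel x0) (pi @^-1` S) by exact: continuous_borel.
have [mP tP cP] := partP.
set D := ~` _ in Dgood.
have mD : @measurable _ (borel x0) D.
  apply: measurableC; apply: fin_bigcup_measurable => // i _.
  by apply: (measurableI _ _ (mpi _ (mP i))); exact: borel_open.
near=> n.
have entn : n%:R * (h + eta) <= static_entropy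
    (pushforward mu (pi : borel x0 -> borel (pi x0)))
    (@join_partition _ (borel (pi x0)) (T : borel (pi x0) -> borel (pi x0)) k P n).
  have n0 : (0 < n)%N by near: n; exists 1%N.
  rewrite mulrC -ler_pdivlMr ?ltr0n //; near: n; exact: ent.
have Pj (y : Y) : exists i, P i y.
  by have : [set: borel (pi x0)] y by []; rewrite -cP => -[i _ Pi]; exists i.
have Puniq i j y : P i y -> P j y -> i = j.
  by move=> Pi Pj'; apply: (tP i j I I); exists y.
have /choice[name nameP] : forall x, exists w : {ffun 'I_n -> 'I_k},
    forall j : 'I_n, P (w j) (pi (iter j f x)).
  move=> x; have /choice[w wP] := fun j : 'I_n => Pj (pi (iter j f x)).
  by exists [ffun j => w j] => j; rewrite ffunE.
have nameE (w : {ffun 'I_n -> 'I_k}) : [set x | name x = w] =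
    pi @^-1` (@join_partition _ (borel (pi x0)) (T : borel (pi x0) -> borel (pi x0)) k P n w).
  apply/seteqP; split=> x /=.
    by move=> <- j; have := nameP x j; rewrite (pi_iter pi_f).
  move=> xw; apply/ffunP => j; apply: (Puniq _ _ (pi (iter j f x))) => //.
  by have := xw j; rewrite (pi_iter pi_f).
have mname w : @measurable _ (borel x0) [set x | name x = w].
  have -> : [set x | name x = w] = \bigcap_(j : 'I_n) (iter j f @^-1` (pi @^-1` P (w j))).
    apply/seteqP; split=> [x /= <- j _|x H]; first exact: nameP.
    by apply/ffunP => j; apply: Puniq (nameP x j) (H j I).
  apply: fin_bigcap_measurable => // j _.
  by apply: (@iter_measurable _ (borel x0) f mf); exact: mpi.
have entE : static_entropy (pushforward mu (pi : borel x0 -> borel (pi x0)))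
    (@join_partition _ (borel (pi x0)) (T : borel (pi x0) -> borel (pi x0)) k P n) =
    - \sum_w prob mu [set x | name x = w] * ln (prob mu [set x | name x = w]).
  by congr (- _); apply: eq_bigr => w _; rewrite nameE.
have sum1 : \sum_w prob mu [set x | name x = w] = 1.
  have [_ <-] := prob_fibers mu (g := name) xpredT mname.
  by rewrite -(probT mu); congr prob; apply/seteqP.
pose B1 : set X := [set x | ~ (pickle (code x (- m%:Z)) < N)%N].
(* The letter at n + m is the letter at - m seen n + m + m steps later, so by invariance this event
   has the measure of [B1]. *)
pose B2 : set X := iter (n + m + m) f @^-1` B1.
pose B3 : set X := [set x | e * n%:R < #|visits f D n x|%:R].
have mB1 : @measurable _ (borel x0) B1.
  by apply: borel_open; exact: (@code_open _ _ _ _ phi_homeo _ [set v | ~ (pickle v < N)%N]).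
have mB2 : @measurable _ (borel x0) B2 by exact: (@iter_measurable _ (borel x0) f mf).
have [mB3 pB3] := @frequent_visits R _ (borel x0) mu f mf inv D n e mD e0.
rewrite -/B3 in mB3 pB3.
have pB2 : prob mu B2 <= e by rewrite (@prob_iter R _ (borel x0) mu f mf inv).
have {pB3}pB3 : prob mu B3 <= e.
  by apply: (le_trans pB3); rewrite ler_pdivrMr.
pose B : set X := B1 `|` B2 `|` B3.
have mB : @measurable _ (borel x0) B by exact: (measurableU _ _ (measurableU _ _ mB1 mB2) mB3).
have pB : prob mu B <= 3 * e.
  have -> : 3 * e = e + e + e by rewrite -[3]/(2 + 1)%:R natrD mulrDl mul1r mulr_natl.
  apply: (le_trans (probU_le mu (measurableU _ _ mB1 mB2) mB3)).
  by apply: lerD => //; apply: (le_trans (probU_le mu mB1 mB2)); exact: lerD.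
pose W : {set {ffun 'I_n -> 'I_k}} := [set w | `[< exists x, ~ B x /\ name x = w >]]%SET.
have /choice[pt ptP] : forall w, exists x, w \in W -> ~ B x /\ name x = w.
  move=> w; have [|nw] := boolP (w \in W); last by exists x0.
  by rewrite inE => /asboolP[x xw]; exists x.
have W0 : (0 < #|W|)%N.
  have [x nBx] : exists x, ~ B x.
    apply: contrapT => H; have : prob mu B = 1.
      rewrite -(probT mu); congr prob; apply/seteqP; split=> // x _.
      by apply: contrapT => nB; apply: H; exists x.
    by move=> h1; move: pB; rewrite h1 leNgt e1.
  apply/card_gt0P; exists (name x); rewrite inE; apply/asboolP.
  by exists x.
have qW : \sum_(w | w \notin W) prob mu [set x | name x = w] <= 3 * e.
  have [mQ <-] := prob_fibers mu (g := name) (fun w => w \notin W) mname.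
  apply: le_trans pB; apply: prob_le => // x /= nW; apply: contrapT => nB.
  by move: nW; rewrite inE => /asboolP; apply; exists x.
exists W, pt; split=> //.
  apply: (le_trans entn); rewrite entE.
  have := entropy_le_card W0 (fun w => prob_ge0 mu [set x | name x = w]) sum1 qW.
  have k0 : (0 < k)%N.
    by have [i _] := Pj (pi x0); case: (k) i => // -[].
  by rewrite card_ffun !card_ord natrX lnXn ?ltr0n // -[ln k%:R *+ n]mulr_natl.
move=> w /ptP[nB nw].
have n1 : ~ B1 (pt w) by move=> b; apply: nB; left; left.
have n2 : ~ B2 (pt w) by move=> b; apply: nB; left; right.
have n3 : ~ B3 (pt w) by move=> b; apply: nB; right.
split.
- by apply: contrapT.
- apply: contrapT => H; apply: n2; rewrite /B2 /B1 /= (code_iter phi_f) /shift_by.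
  by rewrite addnC PoszD addKr.
- exists (visits f D n (pt w)); first by rewrite leNgt; apply/negP.
  move=> j; rewrite inE => /asboolP/contrapT[i _ [Pi gi]].
  suff -> : w j = i by [].
  by have Pw := nameP (pt w) j; rewrite nw in Pw; exact: Puniq Pw Pi.
Unshelve. all: by end_near.
Qed.

End names.

(** * Separated loops *)

Section separated_loops.
Variables (R : realType) (X Y : topologicalType) (f : X -> X) (pi : X -> Y).
Variables (V : countType) (E : rel V) (phi : X -> markov_shift E).
Hypothesis phi_f : forall x, phi (f x) = markov_map E (phi x).
Hypothesis pi_f_eq : forall n x y, pi x = pi y -> pi (iter n f x) = pi (iter n f y).
Notation code := (code phi).
Variables (k m n : nat) (good : 'I_k -> set X).
Hypothesis good_agree : forall i x y, agree m (code y) (code x) -> good i x -> good i y.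
Hypothesis good_sep : forall i j x y, i != j -> good i x -> good j y -> pi x <> pi y.
Notation word := {ffun 'I_n -> 'I_k}.
Variables (e : R) (S : {set word}) (pt : word -> X) (bad : word -> {set 'I_n}).
Hypothesis bad_small : forall w, w \in S -> #|bad w|%:R <= e * n%:R.
Hypothesis bad_good : forall w j, w \in S -> j \notin bad w ->
  good (w j) (iter j f (pt w)).
Hypothesis S_sep : forall w w', w \in S -> w' \in S -> w != w' ->
  4 * (e * n%:R) < (hamming w w')%:R.
Variables (v a b : V) (c1 c2 : nat) (pre post : nat -> V).
Hypothesis pt_a : forall w, w \in S -> code (pt w) (- m%:Z) = a.
Hypothesis pt_b : forall w, w \in S -> code (pt w) (n + m)%N%:Z = b.
Hypotheses (pre_walk : walk_word E v a c1 pre) (post_walk : walk_word E b v c2 post).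
Hypothesis n_gt0 : (0 < n)%N.

Definition loop_length : nat := (c1 + (n + m + m + c2))%N.
Notation L := loop_length.

Hypothesis L_small : (c1 + m + m + c2)%N%:R <= e * n%:R.

(** The orbit segment is kept with a margin of [m] letters on each side of the [n] labelled times,
    so that the window deciding each label lies inside the loop. *)
Definition loop_word (w : word) : nat -> V :=
  cat_word c1 pre (cat_word (n + m + m) (fun j => code (pt w) (j%:Z - m%:Z)) post).

Lemma loop_length_gt0 : (0 < L)%N.
Proof. by rewrite /loop_length !addn_gt0 n_gt0 orbT. Qed.

Lemma loop_word_walk w : w \in S -> walk_word E v v L (loop_word w).
Proof.
move=> wS; apply: walk_word_cat pre_walk _; apply: walk_word_cat post_walk.
split; first by rewrite sub0r pt_a.
  by rewrite -(pt_b wS); congr code; lia.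
move=> i _; have := code_markov phi (pt w) (i%:Z - m%:Z).
by have -> : i%:Z - m%:Z + 1 = i.+1%:Z - m%:Z by lia.
Qed.

Lemma loop_word_mid w (j : nat) : (j < n + m + m)%N ->
  loop_word w (c1 + j)%N = code (pt w) (j%:Z - m%:Z).
Proof. by move=> jl; rewrite /loop_word /cat_word ltnNge leq_addr addKn jl. Qed.

(* A rotation of [loop_word w] carries the labels of [w], except at the bad times
   of [w] and around the junction. *)
Lemma loop_word_good w t x (j : nat) (j0 : 'I_n) : w \in S ->
  (forall l : nat, (l < L)%N -> code x l%:Z = loop_word w ((t + l) %% L)%N) ->
  (j < n)%N -> ((t + (c1 + m + j)) %% L = c1 + m + j0)%N -> j0 \notin bad w ->
  good (w j0) (iter (c1 + m + j) f x).
Proof.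
move=> wS xw jn qE nb; apply: good_agree (bad_good wS nb) => i im.
rewrite !(code_iter phi_f) /shift_by.
have [i' iE] : exists i' : nat, i = i'%:Z - m%:Z by exists (absz (i + m%:Z)%R); lia.
have -> : i + (c1 + m + j)%N%:Z = (c1 + j + i')%N%:Z by lia.
have -> : i + j0%:Z = (j0 + i')%N%:Z - m%:Z by lia.
have j0n := ltn_ord j0.
rewrite xw; last by rewrite /L; lia.
rewrite -loop_word_mid; last by lia.
congr loop_word.
have := divn_eq (t + (c1 + m + j)) L; rewrite qE => tE.
have -> : (t + (c1 + j + i') = (t + (c1 + m + j)) %/ L * L + (c1 + (j0 + i')))%N by lia.
by rewrite modnMDl modn_small // /L; lia.
Qed.

Lemma loop_word_good0 w x (j : 'I_n) : w \in S ->
  (forall l : nat, (l < L)%N -> code x l%:Z = loop_word w l) ->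
  j \notin bad w -> good (w j) (iter (c1 + m + j) f x).
Proof.
move=> wS xw nb; have jn := ltn_ord j.
apply: (loop_word_good (t := 0%N) wS) => //.
  by move=> l lL; rewrite add0n modn_small // xw.
by rewrite add0n modn_small // /L; lia.
Qed.

Lemma good_same i j q x y : good i (iter q f x) -> good j (iter q f y) ->
  pi x = pi y -> i = j.
Proof.
move=> gi gj xy; apply/eqP; apply: contraT => ij.
by case: (good_sep ij gi gj); exact: pi_f_eq.
Qed.

(** At times that are bad for neither word, equal images force equal labels. The words could then
    differ at no more than 2 * e * n places, fewer than their separation allows. *)
Lemma loop_word_aligned_sep w w' x y : w \in S -> w' \in S -> w != w' ->
  (forall l : nat, (l < L)%N -> code x l%:Z = loop_word w l) ->
  (forall l : nat, (l < L)%N -> code y l%:Z = loop_word w' l) -> pi x <> pi y.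
Proof.
move=> wS w'S ww' xw yw' xy; have := S_sep wS w'S ww'; rewrite ltNge => /negP; apply.
have sub : [set j | w j != w' j]%SET \subset bad w :|: bad w'.
  apply/fintype.subsetP => j; rewrite !inE; apply: contraR; rewrite negb_or.
  move=> /andP[nb nb']; apply/eqP.
  exact: (good_same (loop_word_good0 wS xw nb) (loop_word_good0 w'S yw' nb') xy).
have := leq_trans (subset_leq_card sub) (leq_card_setU _ _).
rewrite -(ler_nat R) natrD => /le_trans; apply.
have := bad_small wS; have := bad_small w'S; have : 0 <= e * n%:R.
  by apply: le_trans (bad_small wS).
by lra.
Qed.

Definition compatible (w0 : word) (t : nat) (w : word) : Prop := exists x y,
  [/\ forall l : nat, (l < L)%N -> code x l%:Z = loop_word w l,
      forall l : nat, (l < L)%N -> code y l%:Z = loop_word w0 ((t + l) %% L)%N &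
      pi x = pi y].

(** The rotation by [t] of the loop of [w0] dictates the labels of both words, except at the bad
    times of [w], of [w'] and of [w0], and near the junction. Each of these four sets has at most e
    * n elements, whence the separation 4 * (e * n). *)
Lemma compatible_uniq w0 t w w' : w0 \in S -> w \in S -> w' \in S ->
  compatible w0 t w -> compatible w0 t w' -> w = w'.
Proof.
move=> w0S wS w'S [x [y [xw yt xy]]] [x' [y' [xw' yt' xy']]].
apply/eqP; apply: contraT => ww'; exfalso.
have := S_sep wS w'S ww'; rewrite ltNge => /negP; apply.
have nL : (n <= L)%N by rewrite /L; lia.
have pos_lt (j : 'I_n) : (c1 + m + j < L)%N by have := ltn_ord j; rewrite /L; lia.
pose pos (j : 'I_n) : 'I_L := Ordinal (pos_lt j).
have rot_lt (j : 'I_n) : ((t + (c1 + m + j)) %% L < L)%N.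
  by rewrite ltn_mod loop_length_gt0.
pose rot (j : 'I_n) : 'I_L := Ordinal (rot_lt j).
have pos_inj : injective pos by move=> i j [] /addnI /ord_inj.
have rot_inj : injective rot.
  move=> i j /(congr1 val) /= /eqP; rewrite !addnA eqn_modDl => /eqP.
  by rewrite !modn_small ?(leq_trans (ltn_ord _)) // => /ord_inj.
(* [Z] collects the positions of the cycle at which [w0] shows no good label: the L - n positions
   that correspond to no labelled time, and the bad times of [w0]. *)
pose Z := ~: (pos @: ~: bad w0).
have cZ : (#|Z| = L - n + #|bad w0|)%N.
  have := cardsC (pos @: ~: bad w0); rewrite -/Z card_imset //.
  have := cardsC (bad w0); rewrite !card_ord.
  by move: nL; move: #|bad w0| #|~: bad w0| #|Z| => i1 i2 i3; lia.
pose J : {set 'I_n} := [set j | rot j \in Z]%SET.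
have cJ : (#|J| <= #|Z|)%N.
  rewrite -(card_imset _ rot_inj); apply: subset_leq_card.
  by apply/fintype.subsetP => z /imsetP[j]; rewrite inE => jZ ->.
have sub : [set j | w j != w' j]%SET \subset bad w :|: bad w' :|: J.
  apply/fintype.subsetP => j; rewrite !inE; apply: contraR; rewrite !negb_or negbK.
  move=> /andP[/andP[nb nb']] /imsetP[j0]; rewrite inE => nb0 /(congr1 val) /= q.
  have g := loop_word_good w0S yt (ltn_ord j) q nb0.
  have g' := loop_word_good w0S yt' (ltn_ord j) q nb0.
  apply/eqP; rewrite (good_same (loop_word_good0 wS xw nb) g xy).
  by rewrite (good_same (loop_word_good0 w'S xw' nb') g' xy').
have LnE : (L - n = c1 + m + m + c2)%N by rewrite /L; lia.
rewrite cZ LnE in cJ.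
have : (hamming w w' <= #|bad w| + #|bad w'| + (c1 + m + m + c2 + #|bad w0|))%N.
  apply: (leq_trans (subset_leq_card sub)); apply: (leq_trans (leq_card_setU _ _)).
  by apply: leq_add; first exact: leq_card_setU.
rewrite -(ler_nat R) !natrD => /le_trans; apply.
have := bad_small wS; have := bad_small w'S; have := bad_small w0S.
by move: L_small; rewrite !natrD; lra.
Qed.

(** A rotation matters only modulo the loop length, and each one is compatible with at most one
    word, so the discarded words inject into the rotations. *)
Lemma separated_loops (w0 : word) : w0 \in S ->
  exists (A : nat -> V) (I : finType) (beta : I -> nat -> V),
  [/\ walk_word E v v L A, forall i, walk_word E v v L (beta i),
      forall i j x y, i != j ->
        (forall l : nat, (l < L)%N -> x l%:Z = beta i l) ->
        (forall l : nat, (l < L)%N -> y l%:Z = beta j l) -> ~ fiber_rel pi phi x y,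
      forall i t x y,
        (forall l : nat, (l < L)%N -> x l%:Z = beta i l) ->
        (forall l : nat, (l < L)%N -> y l%:Z = A ((t + l) %% L)%N) ->
        ~ fiber_rel pi phi x y &
      (#|S| <= #|I| + L)%N].
Proof.
move=> w0S.
pose S1 : {set word} := [set w in S | `[< forall t, ~ compatible w0 t w >]]%SET.
have S1S w : w \in S1 -> w \in S by rewrite inE => /andP[].
have S1c w t : w \in S1 -> ~ compatible w0 t w.
  by rewrite inE => /andP[_ /asboolP].
exists (loop_word w0), {w | w \in S1}, (fun i => loop_word (val i)); split.
- exact: loop_word_walk.
- by move=> i; apply: loop_word_walk; exact: S1S (valP i).
- move=> i j x y ij xi yj [x' [y' [xE yE xy]]]; subst x y.
  exact: (loop_word_aligned_sep (S1S _ (valP i)) (S1S _ (valP j)) _ xi yj xy).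
- move=> i t x y xi yt [x' [y' [xE yE xy]]]; subst x y.
  by apply: (S1c _ t (valP i)); exists x', y'.
have -> : #|{: {w : word | w \in S1}}| = #|S1| by rewrite card_sig; exact: eq_card.
have : (#|S :\: S1| <= L)%N.
  have /choice[t tP] : forall w, exists t : 'I_L,
      w \in S :\: S1 -> compatible w0 t w.
    move=> w; case: (boolP (w \in S :\: S1)) => wS; last first.
      by exists (Ordinal loop_length_gt0).
    move: wS; rewrite !inE => /andP[nS1 wS]; rewrite wS /= in nS1.
    have [t tc] : exists t, compatible w0 t w.
      apply: contrapT => H; move/negP: nS1; apply; apply/asboolP => t tc.
      by apply: H; exists t.
    have tL : (t %% L < L)%N by rewrite ltn_mod loop_length_gt0.
    exists (Ordinal tL) => _; have [x [y [xw yt xy]]] := tc.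
    by exists x, y; split=> // l lL; rewrite yt //= modnDml.
  rewrite -[leqRHS]card_ord -(card_in_imset (f := t)); first exact: max_card.
  move=> w w' wD w'D ttE; have cw := tP w wD; have cw' := tP w' w'D.
  rewrite -ttE in cw'; move: wD w'D; rewrite !inE => /andP[_ wS] /andP[_ w'S].
  exact: compatible_uniq cw cw'.
have S1sub : S1 \subset S by apply/fintype.subsetP => w /S1S.
by rewrite -[X in _ -> (X <= _)%N](cardsID S1 S) (finset.setIidPr S1sub) leq_add2l.
Qed.

End separated_loops.

Lemma card_pigeonhole (T U : finType) (W : {set T}) (g : T -> U) :
  (0 < #|W|)%N ->
  exists c, (#|W| <= #|U| * #|[set w in W | g w == c]%SET|)%N.
Proof.
move=> /card_gt0P[w0 _]; pose F c := #|[set w in W | g w == c]%SET|.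
case: (@arg_maxnP _ (g w0) xpredT F isT) => c _ cmax; exists c.
rewrite -sum1_card (partition_big g xpredT) //= -sum_nat_const.
apply: leq_sum => d _; apply: leq_trans (cmax d isT).
by rewrite sum1_card; apply: subset_leq_card; apply/fintype.subsetP => w; rewrite !inE.
Qed.

(** Distances to [v] may be unbounded in an infinite graph; the bound over finitely many vertices
    keeps the closing paths short compared with [n]. *)
Lemma bounded_connections (V : countType) (E : rel V) (v : V) (N : nat) :
  strongly_connected E ->
  exists C : nat, forall u, (pickle u < N)%N ->
    (exists l a, (l <= C)%N /\ walk_word E v u l a) /\
    (exists l a, (l <= C)%N /\ walk_word E u v l a).
Proof.
move=> Ec; elim: N => [|N [C CP]]; first by exists 0%N.
have [[u uN]|nu] := pselect (exists u : V, pickle u = N); last first.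
  exists C => u; rewrite ltnS leq_eqVlt => /orP[/eqP uN|/CP //].
  by case: nu; exists u.
have [l1 [a1 w1]] := connected_walk_word Ec v u.
have [l2 [a2 w2]] := connected_walk_word Ec u v.
exists (C + l1 + l2)%N => u'; rewrite ltnS leq_eqVlt => /orP[/eqP uN'|/CP[]].
  have -> : u' = u by apply: (pcan_inj pickleK); rewrite uN uN'.
  by split; [exists l1, a1|exists l2, a2]; split=> //; lia.
move=> [k1 [b1 [h1 x1]]] [k2 [b2 [h2 x2]]].
by split; [exists k1, b1|exists k2, b2]; split=> //; lia.
Qed.

(** The final count: loops have length at most n + C, more than exp(h * L) of them must survive
    after up to [L] are discarded, and [c] absorbs the bounded factors lost on the way. *)
Lemma expR_growth (R : realType) (h eta c C : R) : 0 < eta -> 0 <= h -> 0 <= C ->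
  \forall n \near \oo, expR (h * (n%:R + C)) + (n%:R + C) <
    expR (n%:R * (h + eta / 2) - c).
Proof.
(* Of the gain n * eta / 2, one half beats all constants, here [B], and the other half is at least
   linear; the term 4 / eta turns n * eta / 4 into [n]. *)
move=> eta0 h0 C0; pose B := 1 + C + 4 / eta.
have e4 : 0 < eta / 4 by rewrite divr_gt0.
have B0 : 0 < B by rewrite /B addr_gt0 ?divr_gt0 // ltr_wpDr.
near=> n.
have n0 : 0 <= n%:R :> R by [].
have big : B <= expR (n%:R * (eta / 4) - (c + h * C)).
  apply: le_trans (expR_ge1Dx _).
  have : (B + c + h * C) / (eta / 4) <= n%:R by near: n; exact: nbhs_infty_ger.
  by rewrite ler_pdivrMr // => ?; lra.
have lin : 1 + n%:R * (eta / 4) <= expR (n%:R * (eta / 4)) := expR_ge1Dx _.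
have E1 : expR (n%:R * (h + eta / 2) - c) = expR (h * (n%:R + C)) *
    (expR (n%:R * (eta / 4) - (c + h * C)) * expR (n%:R * (eta / 4))).
  by rewrite -!expRD; congr expR; field.
have x1 : 1 <= expR (h * (n%:R + C)) by rewrite -expR0 ler_expR mulr_ge0 // addr_ge0.
have prod : 1 + n%:R + C < expR (n%:R * (eta / 4) - (c + h * C)) * expR (n%:R * (eta / 4)).
  apply: lt_le_trans (ler_pM (ltW B0) _ big lin); last first.
    by rewrite addr_ge0 // mulr_ge0 // ltW.
  have -> : B * (1 + n%:R * (eta / 4)) = 1 + n%:R + C + 4 / eta + (1 + C) * (n%:R * (eta / 4)).
    by rewrite /B; field; exact: lt0r_neq0.
  have : 0 < 4 / eta by rewrite divr_gt0.
  have : 0 <= (1 + C) * (n%:R * (eta / 4)) by rewrite !mulr_ge0 ?addr_ge0 // ltW.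
  by lra.
rewrite E1; move: (expR (h * _)) x1 prod => x x1; set y := expR _ * expR _ => prod.
have : 0 <= (x - 1) * (y - 1) by rewrite mulr_ge0 // subr_ge0 //; lra.
by rewrite mulrBl !mulrBr mulr1 !mul1r; lra.
Unshelve. all: by end_near.
Qed.

(** * Choice of the parameters and count of the loops *)

Section counting.
Variables (R : realType) (X Y : topologicalType).
Variables (f : X -> X) (T : Y -> Y) (pi : X -> Y).
Variables (V : countType) (E : rel V) (phi : X -> markov_shift E).
Hypotheses (phi_homeo : homeomorphism phi)
  (phi_f : forall x, phi (f x) = markov_map E (phi x)).
Hypotheses (cpi : continuous pi) (pi_f : forall x, pi (f x) = T (pi x)).
Hypotheses (polY : polish R Y) (E_conn : strongly_connected E).
Variables (x0 : X) (mu : probability (borel x0) R).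
Hypothesis inv : invariant_measure (f : borel x0 -> borel x0) mu.
Variables (k : nat) (P : 'I_k -> set (borel (pi x0))) (h : R).
Hypotheses (partP : finite_partition P) (h_ge0 : 0 <= h).
Hypothesis h_lt : h < partition_entropy (T : borel (pi x0) -> borel (pi x0))
  (pushforward mu (pi : borel x0 -> borel (pi x0))) P.

Lemma many_separated_loops : exists (v : V) (L : nat) (A : nat -> V) (I : finType)
    (beta : I -> nat -> V),
  [/\ (0 < L)%N /\ walk_word E v v L A, forall i, walk_word E v v L (beta i),
      forall i j x y, i != j ->
        (forall l : nat, (l < L)%N -> x l%:Z = beta i l) ->
        (forall l : nat, (l < L)%N -> y l%:Z = beta j l) -> ~ fiber_rel pi phi x y,
      forall i t x y,
        (forall l : nat, (l < L)%N -> x l%:Z = beta i l) ->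
        (forall l : nat, (l < L)%N -> y l%:Z = A ((t + l) %% L)%N) ->
        ~ fiber_rel pi phi x y &
      h * L%:R < ln #|I|%:R].
Proof.
have [eta eta0 H] := many_names phi_homeo phi_f cpi pi_f polY inv partP h_ge0 h_lt.
(* Three losses of at most n * d each are to come, one from the entropy bound and two from the
   Hamming balls; together they stay below n * eta / 2, which is 8 * n * d. *)
pose d := eta / 16; have d0 : 0 < d by rewrite divr_gt0.
pose tau : R := k%:R / d; have tau0 : 0 <= tau by rewrite divr_ge0 // ltW.
have ktau : k%:R * expR (- tau) <= d.
  have k0 : 0 <= k%:R :> R by [].
  have := expR_ge1Dx tau; rewrite expRN => h1.
  have e0 : 0 < expR tau := expR_gt0 _.
  rewrite ler_pdivrMr //.
  have -> : k%:R = d * tau by rewrite /tau mulrC divfK ?gt_eqF.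
  by rewrite ler_wpM2l ?(ltW d0) //; lra.
have lk0 : 0 <= ln (k%:R : R).
  by case: (k) => [|k']; [rewrite ln0|rewrite ln_ge0 // ler1n].
(* With [e * q = d], every summand of [q] times [e] is at most [d]: this bounds the ball exponent 4
   * e * tau, the entropy error 3 * e * ln k, and [e] itself through 6 * e * d. *)
pose q := 1 + 6 * d + 4 * tau + 3 * ln k%:R.
have q0 : 0 < q by rewrite /q; lra.
pose e := d / q; have e0 : 0 < e by rewrite divr_gt0.
have eq_ : e * q = d by rewrite /e divfK ?gt_eqF.
have et : 0 <= e * tau by rewrite mulr_ge0 // ltW.
have el : 0 <= e * ln k%:R by rewrite mulr_ge0 // ltW.
have ed : 0 < e * d by rewrite mulr_gt0.
have e4 : 4 * (e * tau) <= d.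
  by rewrite -[leRHS]eq_ /q !mulrDr; lra.
have e3 : 3 * (e * ln k%:R) <= d.
  by rewrite -[leRHS]eq_ /q !mulrDr; lra.
have e1 : 3 * e < 1.
  have : e * (6 * d) <= d by rewrite -[leRHS]eq_ /q !mulrDr; lra.
  by rewrite mulrA ger_pMl //; lra.
have [m [N [good [gagree gsep gnear]]]] := H e e0 e1.
pose v := code phi x0 0.
have [C CP] := bounded_connections v N E_conn.
pose C' := (C + C + m + m)%N.
(* The term [ln 2] comes from the entropy bound, the other one from fixing the two end letters by
   pigeonhole. *)
pose c : R := ln 2 + ln ((N.+1 * N.+1)%N%:R).
have big1 : \forall n \near \oo, C'%:R <= e * n%:R /\ (0 < n)%N.
  near=> n; split; last by near: n; exists 1%N.
  by rewrite mulrC -ler_pdivrMr //; near: n; exact: nbhs_infty_ger.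
have [N1 _ H1] := big1; have [N2 _ H2] := expR_growth c eta0 h_ge0 (ler0n R C').
have [N3 _ H3] := gnear.
have [n [nN1 nN2 nN3]] : exists n, [/\ (N1 <= n)%N, (N2 <= n)%N & (N3 <= n)%N].
  by exists (maxn N1 (maxn N2 N3)); rewrite !leq_max !leqnn !orbT.
have [Cn n0] := H1 n nN1; have /= growth := H2 n nN2.
have [W [pt [W0 entW Wpt]]] := H3 n nN3.
move=> {H1 H2 H3 nN1 nN2 nN3 gnear big1}.
have /choice[bad badP] w : exists b : {set 'I_n}, w \in W ->
    #|b|%:R <= e * n%:R /\ forall j, j \notin b -> good (w j) (iter j f (pt w)).
  have [wW|] := boolP (w \in W); last by exists finset.set0.
  by have [_ _ [b b1 b2]] := Wpt w wW; exists b.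
(* All loops must use the same two closing paths to have a common length, so the end letters are
   made equal; their codes are below [N], where [inord] is faithful. *)
pose key w : 'I_N.+1 * 'I_N.+1 := (inord (pickle (code phi (pt w) (- m%:Z))),
  inord (pickle (code phi (pt w) (n + m)%N%:Z))).
have [ab abW] := card_pigeonhole key W0.
set S0 := [set w in W | key w == ab]%SET in abW.
have [w1 w1S] : exists w1, w1 \in S0.
  apply/card_gt0P; rewrite lt0n; apply: contraTneq abW => ->.
  by rewrite muln0 -ltnNge.
have S0W w : w \in S0 -> w \in W by rewrite inE => /andP[].
pose a := code phi (pt w1) (- m%:Z); pose b := code phi (pt w1) (n + m)%N%:Z.
have keyE w : w \in S0 -> code phi (pt w) (- m%:Z) = a /\
    code phi (pt w) (n + m)%N%:Z = b.
  move=> wS; have [p1 p2 _] := Wpt w (S0W w wS).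
  have [q1 q2 _] := Wpt w1 (S0W w1 w1S).
  have : key w = key w1.
    by move: wS w1S; rewrite !inE => /andP[_ /eqP ->] /andP[_ /eqP ->].
  move=> [/(congr1 val) /= k1 /(congr1 val) /= k2].
  by split; apply: (pcan_inj pickleK);
    [move: k1|move: k2]; rewrite !inordK // ltnS ltnW.
have [aN bN _] := Wpt w1 (S0W w1 w1S).
have [[c1 [pre [c1C preW]]] _] := CP a aN.
have [_ [c2 [post [c2C postW]]]] := CP b bN.
have rho0 : 0 <= 4 * (e * n%:R) by rewrite mulr_ge0 // mulr_ge0 // ltW.
have [S [SS0 Ssep Scard]] := hamming_separated S0 tau0 rho0.
have SS0' w : w \in S -> w \in S0 by move/fintype.subsetP: SS0; apply.
have WS : #|W|%:R <= (N.+1 * N.+1)%N%:R * (#|S|%:R * expR (n%:R * (d + d))) :> R.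
  have h1 : #|W|%:R <= (N.+1 * N.+1)%N%:R * #|S0|%:R :> R.
    by rewrite -natrM ler_nat; move: abW; rewrite card_prod !card_ord.
  apply: (le_trans h1); rewrite ler_wpM2l //; apply: (le_trans Scard).
  rewrite ler_wpM2l // mulrDr expRD; apply: ler_pM.
  - exact: expR_ge0.
  - by rewrite exprn_ge0 // addr_ge0 // mulr_ge0 // expR_ge0.
  - rewrite ler_expR; have -> : tau * (4 * (e * n%:R)) = n%:R * (4 * (e * tau)) by ring.
    exact: ler_wpM2l.
  - rewrite expRM_natl; have k1 : 0 <= 1 + k%:R * expR (- tau).
      by rewrite addr_ge0 // mulr_ge0 // expR_ge0.
    have k2 : 1 + k%:R * expR (- tau) <= expR d.
      by apply: (le_trans (expR_ge1Dx _)); rewrite ler_expR.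
    by apply: lerXn2r; rewrite ?nnegrE ?expR_ge0.
have S_gt0 : 0 < #|S|%:R :> R.
  rewrite ltr0n lt0n; apply: contraTneq WS => ->.
  by rewrite mul0r mulr0 -ltNge ltr0n.
have [w0 w0S] : exists w0, w0 \in S by apply/card_gt0P; rewrite -(ltr0n R).
have lnS : n%:R * (h + eta / 2) - c <= ln #|S|%:R.
  have NN : 0 < (N.+1 * N.+1)%N%:R :> R by rewrite ltr0n.
  have lnW : ln #|W|%:R <= ln (N.+1 * N.+1)%N%:R + (ln #|S|%:R + n%:R * (d + d)) :> R.
    rewrite -[X in _ + (_ + X)]expRK -!lnM ?posrE ?expR_gt0 ?mulr_gt0 ?expR_gt0 //.
    by rewrite ler_ln ?posrE ?ltr0n ?mulr_gt0 ?expR_gt0.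
  have nn : 0 <= n%:R :> R by [].
  have e3n : 3 * e * (n%:R * ln k%:R) <= n%:R * d.
    have -> : 3 * e * (n%:R * ln k%:R) = n%:R * (3 * (e * ln k%:R)) by ring.
    exact: ler_wpM2l.
  have etad : eta = 16 * d by rewrite /d mulrC divfK.
  have nd : 0 <= n%:R * d by rewrite mulr_ge0 // ltW.
  by move: entW; rewrite /c !mulrDr etad; lra.
pose L := loop_length m n c1 c2.
have LC : L%:R <= n%:R + C'%:R :> R.
  by rewrite -natrD ler_nat /L /loop_length /C'; move: c1C c2C; clear; lia.
have Cs : (c1 + m + m + c2)%N%:R <= e * n%:R.
  by apply: le_trans Cn; rewrite ler_nat /C'; move: c1C c2C; clear; lia.
have pi_eq_iter s x y : pi x = pi y -> pi (iter s f x) = pi (iter s f y).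
  by move=> xy; rewrite !(pi_iter pi_f) xy.
have [A [I [beta [Aw bw s1 s2 card]]]] := separated_loops phi_f
  pi_eq_iter
  gagree gsep (fun w wS => (badP w (S0W w (SS0' w wS))).1)
  (fun w j wS => (badP w (S0W w (SS0' w wS))).2 j) Ssep
  (fun w wS => (keyE w (SS0' w wS)).1) (fun w wS => (keyE w (SS0' w wS)).2)
  preW postW n0 Cs w0S.
exists v, L, A, I, beta; split=> //.
  by split=> //; exact: (loop_length_gt0 _ _ _ n0).
have cardR : #|S|%:R <= #|I|%:R + L%:R :> R by rewrite -natrD ler_nat.
have hL : expR (h * L%:R) <= expR (h * (n%:R + C'%:R)).
  by rewrite ler_expR ler_wpM2l.
have Sbig : expR (n%:R * (h + eta / 2) - c) <= #|S|%:R.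
  by rewrite -[leRHS]lnK ?posrE // ler_expR.
have Ibig : expR (h * L%:R) < #|I|%:R.
  by lra.
by rewrite -[ltLHS]expRK ltr_ln ?posrE ?expR_gt0 // (lt_trans (expR_gt0 _) Ibig).
Unshelve. all: by end_near.
Qed.

End counting.

Lemma polish_hausdorff (R : realType) (Y : topologicalType) :
  polish R Y -> hausdorff_space Y.
Proof.
move=> [_ [dist [[d_ge0 d0 dsym dtri] [dnbhs _]]]] x y cxy; apply: contrapT => xy.
have dxy : 0 < dist x y by rewrite lt_neqAle d_ge0 andbT eq_sym; apply/eqP => /d0.
have half z : nbhs z [set t | dist z t < dist x y / 2].
  by apply/dnbhs; exists (dist x y / 2); rewrite ?divr_gt0.
have [z [/= zx zy]] := cxy _ _ (half x) (half y).
by have := dtri x z y; rewrite (dsym z y); lra.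
Qed.

Theorem theorem1p10 (R : realType) (V : countType) (E : rel V) (p : nat)
    (Y : topologicalType) (T : Y -> Y) (pi : markov_shift E -> Y) (h : R)
    (irrE : irreducible_markov (markov_map E) p)
    (finE : finite_entropy R (markov_map E))
    (polY : polish R Y) (homT : homeomorphism T)
    (cpi : continuous pi)
    (piS : forall x, pi (markov_map E x) = T (pi x))
    (h_ge0 : 0 <= h)
    (h_lt : (h%:E < factor_entropy R (markov_map E) T pi)%E) :
  exists (X' : set (markov_shift E)) (X'S : invariant_set (markov_map E) X'),
    [/\ shift_of_finite_type (restrict_map X'S),
        irreducible_markov (restrict_map X'S) p,
        (h%:E < topological_entropy R (restrict_map X'S))%E &
        set_inj X' pi].
Proof.
(* Connectedness and the period belong to a presentation [F] that may differ from [E], so words are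
   taken in [F] through the conjugacy [phi], while [pi] stays on the shift of [E]. *)
have [W [F [F_conn F_per [phi [phi_homeo phi_f]]]]] := irrE.
have T_inj : injective T by have [_ [g [_ TK _]]] := homT; exact: can_inj TK.
have [_ [x0 [mu [[inv _] ->]]] h_mu] := ereal_sup_gt h_lt.
have [_ [k [P [partP ->]]]] := ereal_sup_gt h_mu; rewrite lte_fin => h_P.
have [v [L [A [I [beta [[L0 Aw] bw s1 s2 hL]]]]]] :=
  many_separated_loops phi_homeo phi_f cpi piS polY F_conn inv partP h_ge0 h_P.
exact: (horseshoe_subshift phi_homeo phi_f T_inj piS cpi (@markov_hausdorff _ _)
  (polish_hausdorff polY) F_conn F_per L0 Aw bw s1 s2 h_ge0 hL).
Qed.
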